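(* Let $L\ge 1$ be an integer, let $\rho,\delta,\zeta>0$, and for $l=1,\dots,L$ let $\alpha_l>0$, $\beta_l>0$. Let $\gamma_1,\dots,\gamma_L$ be independent nonnegative random variables, where $\gamma_l$ has cumulative distribution function $F_{\gamma_l}(\gamma)=\frac{1}{1+(\gamma/(\rho\alpha_l))^{-\beta_l}}$ for $\gamma>0$. Let $f_{\gamma_{SC}}$ be the probability density function of $\gamma_{SC}=\max\{\gamma_1,\dots,\gamma_L\}$, and let $$\overline{P_e}=\int_0^\infty \delta\,\mathrm{erfc}\left(\sqrt{\zeta\gamma}\right)f_{\gamma_{SC}}(\gamma)\,d\gamma$$ be the average bit error rate. Then $$\overline{P_e}=\frac{\delta}{\sqrt{\pi}}\,H_{1,0:1,1;\dots;1,1}^{0,1:1,1;\dots;1,1}\left[\begin{matrix}(\zeta\rho\alpha_1)^{-\beta_1}\\ \vdots\\ (\zeta\rho\alpha_L)^{-\beta_L}\end{matrix}\;\middle|\;\begin{matrix}\left(\tfrac12;\beta_1,\dots,\beta_L\right):(1,1);\dots;(1,1)\\ -:(1,1);\dots;(1,1)\end{matrix}\right],$$ where the pairs $1,1$ and $(1,1)$ after each colon are repeated $L$ times and $H$ is the multivariate Fox H-function.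
   Context: The complementary error function is $\mathrm{erfc}(x)=\frac{2}{\sqrt\pi}\int_x^\infty e^{-t^2}dt$. The multivariate Fox H-function in the claim, at arguments $x_1,\dots,x_L>0$, is the $L$-fold Mellin–Barnes integral $$H_{1,0:1,1;\dots;1,1}^{0,1:1,1;\dots;1,1}[\cdots]=\left(\frac{1}{2\pi i}\right)^L\int_{c_1}\cdots\int_{c_L}\Gamma\left(\tfrac12+\sum_{l=1}^L\beta_l s_l\right)\prod_{l=1}^L\Gamma(1-s_l)\Gamma(s_l)\,x_l^{s_l}\;ds_1\cdots ds_L,$$ where $c_l$ is a vertical line $\mathrm{Re}\,s_l=\sigma_l$ with $0<\sigma_l<1$ (separating the poles of $\Gamma(s_l)$ from those of $\Gamma(1-s_l)$), traversed upward. Here $x_l=(\zeta\rho\alpha_l)^{-\beta_l}$. In the application, $\gamma_l$ is the SNR of the $l$-th branch of a selection combining receiver, $\rho$ is the average transmit SNR, and $\delta,\zeta$ are modulation-dependent parameters. *)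

(* Defs.v *)
From HB Require Import structures.
From mathcomp Require Import all_boot all_order all_algebra.
From mathcomp Require Import all_classical all_reals all_analysis.
From mathcomp Require Import complex.

Set Implicit Arguments.
Unset Strict Implicit.
Unset Printing Implicit Defensive.

Import Order.TTheory GRing.Theory Num.Theory.
Import numFieldNormedType.Exports.

Local Open Scope classical_set_scope.
Local Open Scope complex_scope.
Local Open Scope ring_scope.

Definition mutually_independent d (T : measurableType d) (R : realType)
    (P : probability T R) (I : finType) (X : I -> {RV P >-> R}) : Prop :=
  forall (J : {set I}) (A : I -> set R), (forall i, measurable (A i)) ->
    P (\bigcap_(i in [set` J]) (X i @^-1` A i)) =
    (\prod_(i in J) P (X i @^-1` A i))%E.

Definition is_pdf d (T : measurableType d) (R : realType)
    (P : probability T R) (X : T -> R) (f : R -> R) : Prop :=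
  [/\ measurable_fun [set: R] f,
      forall x, 0 <= f x &
      forall A : set R, measurable A ->
        P (X @^-1` A) = (\int[lebesgue_measure]_(x in A) (f x)%:E)%E].

Section average_bit_error_rate.
Context {R : realType}.

Definition erfc (x : R) : R :=
  2 / Num.sqrt pi *
  \int[lebesgue_measure]_(t in `[x, +oo[) expR (- t ^+ 2).

Definition avg_ber (delta zeta : R) (f : R -> R) : R :=
  \int[lebesgue_measure]_(g in `[0, +oo[)
    (delta * erfc (Num.sqrt (zeta * g)) * f g).

End average_bit_error_rate.

Section fox_H.
Context {R : realType}.

Definition expC (z : R[i]) : R[i] :=
  (expR (complex.Re z))%:C * (cos (complex.Im z) +i* sin (complex.Im z)).

(* Principal branch of x ^ s, for x > 0. *)
Definition cpow (x : R) (s : R[i]) : R[i] := expC (s * (ln x)%:C).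

Definition integralC (D : set R) (f : R -> R[i]) : R[i] :=
  (\int[lebesgue_measure]_(t in D) complex.Re (f t)) +i*
  (\int[lebesgue_measure]_(t in D) complex.Im (f t)).

(* Euler's integral: this is the Gamma function on the half-plane Re z > 0
   only, which is where all its uses in [foxH] lie when beta_l > 0 and
   0 < sigma_l < 1. *)
Definition GammaC (z : R[i]) : R[i] :=
  integralC `]0, +oo[ (fun t => cpow t (z - 1) * (expR (- t))%:C).

(* Upward along the line Re s = sigma: s = sigma + i t and ds = i dt. *)
Definition vline_integral (sigma : R) (g : R[i] -> R[i]) : R[i] :=
  'i%C * integralC [set: R] (fun t => g (sigma +i* t)).

Definition fcons (A : Type) (n : nat) (a : A) (s : 'I_n -> A) : 'I_n.+1 -> A :=
  fun i => oapp s a (unlift ord0 i).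

(* The iterated integral over the lines Re s_l = sigma_l, the variable of
   index 0 being the outermost. *)
Fixpoint vlines_integral (n : nat) :
    ('I_n -> R) -> (('I_n -> R[i]) -> R[i]) -> R[i] :=
  match n with
  | 0 => fun _ g => g (fun=> 0)
  | m.+1 => fun sigma g =>
      vline_integral (sigma ord0) (fun s0 =>
        vlines_integral (fun i => sigma (lift ord0 i))
          (fun s => g (fcons s0 s)))
  end.

(* H^{0,1:1,1;..;1,1}_{1,0:1,1;..;1,1} at x_1, ..., x_L > 0, with first upper
   pair (1/2; beta_1, .., beta_L) and all the other pairs equal to (1,1). *)
Definition foxH (L : nat) (beta sigma x : 'I_L -> R) : R[i] :=
  ((2 * pi)%:C * 'i%C)^-1 ^+ L *
  vlines_integral sigma (fun s =>
    GammaC (2^-1 + \sum_(l < L) (beta l)%:C * s l) *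
    \prod_(l < L) (GammaC (1 - s l) * GammaC (s l) * cpow (x l) (s l))).

End fox_H.

(* Main.v *)
(* Integrating by parts, the error rate is delta / sqrt pi times the integral of
   u^(-1/2) e^(-u) prod_l F_l (u / zeta), and F_l (u / zeta) = 1 / (1 + 1 / X_l)
   with X_l = x_l u^(beta_l).  For 0 < sigma < 1, Mellin inversion gives
   1 / (1 + 1 / X) = 1 / (2 pi i) \int_(Re s = sigma) Gamma(1-s) Gamma(s) X^s ds;
   inserting this for every l and applying Fubini, the remaining u-integral is
   Euler's integral for Gamma(1/2 + sum_l beta_l s_l).

   Mellin inversion itself reduces to Fourier inversion for the function
   e^(sigma y) / (1 + e^y), because Gamma(1-s) Gamma(s) = \int e^(sy) / (1 + e^y) dy;
   it is obtained by Abel summation, the integrability of Gamma(1-s) Gamma(s) along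
   the line being read off Gamma(s+1) = s Gamma(s).  All integrals over ]0, +oo[ are
   transported to the whole line by u = e^w. *)
Require Import Defs.
From HB Require Import structures.
From mathcomp Require Import all_boot all_order all_algebra.
From mathcomp Require Import all_classical all_reals all_analysis.
From mathcomp Require Import complex measurable_realfun ring lra.

Set Implicit Arguments.
Unset Strict Implicit.
Unset Printing Implicit Defensive.

Import Order.TTheory GRing.Theory Num.Theory.
Import numFieldNormedType.Exports.

Local Open Scope classical_set_scope.
Local Open Scope complex_scope.
Local Open Scope ring_scope.

(** * Substitution and the fundamental theorem on the line *)

(** The L-fold integral is iterated, and exchanging it with the u-integral in one go would call for
    integrability in L + 1 variables. The formula is therefore proved by induction on L with Gamma(z
    + sum_l beta_l s_l) in place of Gamma(1/2 + sum_l beta_l s_l), for z free in the half-plane Re z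
    > 0: the outermost variable is absorbed into z. Each step then uses Fubini on the plane only,
    with a majorant that is (1 + t^2)^-1 times a function of w = ln u.

    Fourier inversion is required at a single point. The factor X^s with X = e^lam merely translates
    the logistic function, so inversion at 0 reaches every X, and by parity only the cosine part
    contributes. No residue or contour shift enters: the condition 0 < sigma < 1 acts through the
    decay of e^(sigma y) / (1 + e^y) at both ends and through the positivity of the real parts of s
    and 1 - s. *)

Section real_integrals.
Context {R : realType}.
Implicit Types (f g F : R -> R) (a b m : R).
Local Notation mu := (@lebesgue_measure R).

Let symitv (n : nat) : set R := `[- n%:R, n%:R].

Let bigcup_symitv : \bigcup_n symitv n = setT.
Proof.
rewrite -subTset => x _; exists (Num.truncn `|x|).+1 => //.
have /andP[_ /ltW] := truncn_itv (normr_ge0 x).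
by rewrite ler_norml /symitv /= in_itv.
Qed.

Let symitv_homo : {homo symitv : n m / (n <= m)%N >-> (n <= m)%O}.
Proof.
move=> n p np; apply/subsetPset => x; rewrite /symitv/= !in_itv/= => /andP[nx xn].
have np' : n%:R <= p%:R :> R by rewrite ler_nat.
by rewrite (le_trans _ nx) ?lerN2//= (le_trans xn).
Qed.

Lemma ge0_cvg_integral_sym (f : R -> \bar R) :
  measurable_fun [set: R] f -> (forall x, (0 <= f x)%E) ->
  (\int[mu]_(x in `[(- n%:R)%R, n%:R%R]) f x)%E @[n --> \oo] -->
  (\int[mu]_x f x)%E.
Proof.
move=> mf f0; rewrite -[in X in _ --> X]bigcup_symitv.
apply: (@ge0_nondecreasing_set_cvg_integral _ (measurableTypeR R) R symitv f mu) => //.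
  by move=> n; exact: measurable_itv.
by move=> n; exact: measurable_funTS.
Qed.

Lemma cvg_integral_sym (f : R -> \bar R) :
  mu.-integrable [set: R] f ->
  (\int[mu]_(x in `[(- n%:R)%R, n%:R%R]) f x)%E @[n --> \oo] -->
  (\int[mu]_x f x)%E.
Proof.
move=> fi.
rewrite [in X in _ --> X]integralE.
under eq_fun do rewrite integralE.
have /integrableP[mf _] := fi.
apply: cvgeB.
- apply: fin_num_adde_defl.
  by rewrite fin_numN; exact: integrable_neg_fin_num.
- by apply: ge0_cvg_integral_sym => //; exact: measurable_funepos.
- by apply: ge0_cvg_integral_sym => //; exact: measurable_funeneg.
Qed.

Let continuous_is_derive (F f : R -> R) :
  (forall x : R, is_derive x 1 F (f x)) -> continuous F.
Proof.
move=> dF x; apply/differentiable_continuous/derivable1_diffP.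
by have [] := dF x.
Qed.

Let FTC_sym (f F : R -> R) (n : nat) : continuous f ->
  (forall x : R, is_derive x 1 F (f x)) ->
  (\int[mu]_(x in `[(- n%:R)%R, n%:R%R]) (f x)%:E =
   (F n%:R - F (- n%:R))%:E)%E.
Proof.
move=> cf dF; case: n => [|n].
  by rewrite oppr0 set_itv1 integral_set1 subrr.
have cF := continuous_is_derive dF.
rewrite (@continuous_FTC2 _ f F) ?EFinB//.
- by rewrite (lt_trans (y := 0)) ?oppr_lt0 ?ltr0n.
- exact: continuous_subspaceT.
- split; first by move=> x _; have [] := dF x.
  + by apply: cvg_at_right_filter; exact: cF.
  + by apply: cvg_at_left_filter; exact: cF.
- by move=> x _; rewrite derive1E; have [_] := dF x.
Qed.

(** Monotone convergence over [-n, n] gives the value in the extended reals, so finiteness of the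
    integral is part of the outcome. *)
Lemma ge0_FTC_sym (f F : R -> R) a b : (forall x, 0 <= f x) ->
  continuous f -> (forall x : R, is_derive x 1 F (f x)) ->
  F n%:R @[n --> \oo] --> b -> F (- n%:R) @[n --> \oo] --> a ->
  (\int[mu]_x (f x)%:E = (b - a)%:E)%E.
Proof.
move=> f0 cf dF Fb Fa.
have /cvg_lim <- // : (\int[mu]_(x in `[(- n%:R)%R, n%:R%R]) (f x)%:E)%E
    @[n --> \oo] --> (\int[mu]_x (f x)%:E)%E.
  apply: ge0_cvg_integral_sym => [|x]; last by rewrite lee_fin.
  by apply/measurable_EFinP; exact: continuous_measurable_fun.
apply/cvg_lim => //; under eq_fun do rewrite (FTC_sym _ cf dF).
by apply/cvg_EFin; [exact: nearW|exact: cvgB].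
Qed.

(** Meant for integrands of varying sign: it carries the integration by parts behind Gamma(z + 1) =
    z Gamma(z). *)
Lemma FTC_symT (f F : R -> R) a b : mu.-integrable [set: R] (EFin \o f) ->
  continuous f -> (forall x : R, is_derive x 1 F (f x)) ->
  F n%:R @[n --> \oo] --> b -> F (- n%:R) @[n --> \oo] --> a ->
  \int[mu]_x f x = b - a.
Proof.
move=> fi cf dF Fb Fa; rewrite /Rintegral.
have /cvg_lim <- // := cvg_integral_sym fi.
rewrite (_ : lim _ = (b - a)%:E)//.
apply/cvg_lim => //=; under eq_fun do rewrite (FTC_sym _ cf dF).
by apply/cvg_EFin; [exact: nearW|exact: cvgB].
Qed.

(** The scale [c] covers both changes of variable in use: c = 1 for Euler's integral, and c = 1/2
    for t = e^(w/2), where t^2 = e^w. *)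
Lemma ge0_integration_by_substitution_expR (c : R) (f : R -> R) : 0 < c ->
  {in `]0, +oo[, continuous f} -> (forall x, 0 <= f x) ->
  (\int[mu]_(x in `]0%R, +oo[) (f x)%:E =
   \int[mu]_w (f (expR (c * w)) * (c * expR (c * w)))%:E)%E.
Proof.
move=> c0 cf f0.
pose E (w : R) := expR (c * w).
have dE (w : R) : is_derive w 1 E (c * E w).
  by rewrite /E; apply: is_derive_eq; rewrite /GRing.scale/= mulr1 mulrC.
have cE := continuous_is_derive dE.
have E'E : derive1 E = fun w => c * E w.
  by apply/funext => w; rewrite derive1E; have [_] := dE w.
have E_gt0 w : 0 < E w by exact: expR_gt0.
have E_lt : {homo E : x y / x < y} by move=> x y xy; rewrite ltr_expR ltr_pM2l.
have E_le : {homo E : x y / x <= y} by move=> x y xy; rewrite ler_expR ler_pM2l.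
have cfE : continuous (fun w => f (E w) * (c * E w)).
  move=> w; apply: cvgM.
    by apply: (cvg_comp _ _ (cE w)); apply: cf; rewrite in_itv/= E_gt0.
  by apply: cvgM; [exact: cvg_cst|exact: cE].
(* Images of the intervals [-n, n] under [E]: they exhaust ]0, +oo[, and over each of them the
   substitution takes place on a compact interval. *)
pose D n : set R := `[E (- n%:R), E n%:R]%classic.
have DU : \bigcup_n D n = `]0, +oo[%classic.
  apply/seteqP; split => [x [n _]|x]; rewrite /D/= !in_itv/= => /andP[].
    by move=> Ex _; rewrite andbT (lt_le_trans _ Ex).
  move=> x0 _; have [n _] : (\bigcup_n symitv n) (ln x / c).
    by rewrite bigcup_symitv.
  rewrite /symitv/= in_itv/= => /andP[nx xn]; exists n => //; rewrite /D/= in_itv/=.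
  rewrite -[x]lnK ?posrE// -[ln x](divfK (lt0r_neq0 c0)) mulrC.
  by rewrite !(E_le _ _).
rewrite -DU.
have mfD n : measurable_fun (D n) (EFin \o f).
  have mf : measurable_fun (`]0, +oo[%classic : set R) f.
    by apply: open_continuous_measurable_fun => // x /set_mem; exact: cf.
  apply/measurable_EFinP; apply: measurable_funS mf => //.
  by rewrite -DU; exact: bigcup_sup.
have /cvg_lim <- // : (\int[mu]_(x in D n) (f x)%:E)%E @[n --> \oo] -->
    (\int[mu]_(x in \bigcup_n D n) (f x)%:E)%E.
  apply: (@ge0_nondecreasing_set_cvg_integral _ (measurableTypeR R) R D
    (EFin \o f) mu) => [||//|].
  - move=> n p np; apply/subsetPset => x; rewrite /D/= !in_itv/= => /andP[nx xn].
    have np' : n%:R <= p%:R :> R by rewrite ler_nat.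
    by rewrite (le_trans _ nx) ?E_le ?lerN2//= (le_trans xn)// E_le.
  - by move=> n; exact: measurable_itv.
  - by move=> n x _; rewrite lee_fin.
apply/cvg_lim => //.
rewrite (_ : (fun n => _) = fun n =>
   \int[mu]_(x in `[(- n%:R)%R, n%:R%R]) (f (E x) * (c * E x))%:E)%E.
  apply: ge0_cvg_integral_sym => [|x].
    by apply/measurable_EFinP; exact: continuous_measurable_fun.
  by rewrite lee_fin !mulr_ge0// ltW.
apply/funext => n; rewrite /D integration_by_substitution_increasing.
- by apply: eq_integral => x _; rewrite E'E.
- by rewrite ge0_cp.
- by move=> x y _ _; exact: E_lt.
- by rewrite E'E => x _; apply: cvgM; [exact: cvg_cst|exact: cE].
- rewrite E'E; apply/cvg_ex; eexists; apply: cvg_at_right_filter.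
  by apply: cvgM; [exact: cvg_cst|exact: cE].
- rewrite E'E; apply/cvg_ex; eexists; apply: cvg_at_left_filter.
  by apply: cvgM; [exact: cvg_cst|exact: cE].
- split; first by move=> x _; have [] := dE x.
  + by apply: cvg_at_right_filter; exact: cE.
  + by apply: cvg_at_left_filter; exact: cE.
- apply: continuous_in_subspaceT => x /set_mem/=; rewrite in_itv/= => /andP[Ex _].
  by apply: cf; rewrite in_itv/= andbT (lt_le_trans _ Ex).
Qed.

(** Positive and negative parts are treated separately: the Jacobian e^w is positive, so it commutes
    with taking the maximum with 0. The equality is one of extended reals and covers divergent
    integrals too, so that [GammaCE] can be stated for every z. *)
Lemma integration_by_substitution_expR (f : R -> R) :
  {in `]0, +oo[, continuous f} ->
  (\int[mu]_(x in `]0%R, +oo[) (f x)%:E =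
   \int[mu]_w (f (expR w) * expR w)%:E)%E.
Proof.
move=> cf; rewrite integralE [RHS]integralE.
have maxM x (y z : R) : 0 < x -> Num.max (y * x) 0 = Num.max y 0 * x.
  by move=> x0; rewrite maxr_pMl ?mul0r// ltW.
have cmax (g : R -> R) : {in `]0, +oo[, continuous g} ->
    {in `]0, +oo[, continuous (fun x => Num.max (g x) 0)}.
  by move=> cg x x0; apply: continuous_max; [exact: cg|exact: cvg_cst].
congr (_ - _)%E.
- transitivity (\int[mu]_(x in `]0%R, +oo[) (Num.max (f x) 0)%:E)%E.
    by apply: eq_integral => x _; rewrite funeposE -EFin_max.
  rewrite (@ge0_integration_by_substitution_expR 1)//.
  + apply: eq_integral => x _; rewrite funeposE -EFin_max.
    by rewrite !mul1r maxM ?expR_gt0.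
  + exact: cmax.
  + by move=> x; rewrite le_max lexx orbT.
- transitivity (\int[mu]_(x in `]0%R, +oo[) (Num.max (- f x) 0)%:E)%E.
    by apply: eq_integral => x _; rewrite funenegE -EFinN -EFin_max.
  rewrite (@ge0_integration_by_substitution_expR 1)//.
  + apply: eq_integral => x _; rewrite funenegE -EFinN -EFin_max.
    by rewrite !mul1r -mulNr maxM ?expR_gt0.
  + by apply: cmax => x x0; apply: continuousN; exact: cf.
  + by move=> x; rewrite le_max lexx orbT.
Qed.

End real_integrals.

(** * The two-sided exponential kernel *)

Section exponential_kernel.
Context {R : realType}.
Implicit Types (e v t : R).
Local Notation mu := (@lebesgue_measure R).

(** Adding 1 to the cosine makes the integrand nonnegative as well as even, so that the fundamental
    theorem for nonnegative functions applies on a half-line. The contribution of the 1 is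
    subtracted in [Rintegral_expN_cos]. *)
Lemma integral_expN_1Dcos e v : 0 < e ->
  (\int[mu]_t (expR (- (e * `|t|)) * (1 + cos (t * v)))%:E =
   (2 * (e^-1 + e / (e ^+ 2 + v ^+ 2)))%:E)%E.
Proof.
move=> e0.
have ev0 : 0 < e ^+ 2 + v ^+ 2 by rewrite ltr_pwDl ?exprn_gt0 ?sqr_ge0.
have cosD t : 0 <= 1 + cos (t * v) by have := cos_geN1 (t * v); lra.
have ccos : continuous (fun t => 1 + cos (t * v)).
  move=> t; apply: cvgD; first exact: cvg_cst.
  apply: (@cvg_comp _ _ _ (fun t => t * v) (@cos R) _ (nbhs (t * v))).
    by apply: cvgM; [exact: cvg_id|exact: cvg_cst].
  exact: continuous_cos.
pose f t := expR (- (e * t)) * (1 + cos (t * v)).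
have cf : continuous f.
  move=> t; apply: cvgM; last exact: ccos.
  apply: (@cvg_comp _ _ _ (fun t => - (e * t)) (@expR R) _ (nbhs (- (e * t)))).
    by apply: cvgN; apply: cvgM; [exact: cvg_cst|exact: cvg_id].
  exact: continuous_expR.
(* The antiderivative of exp(-e t), plus the real part of -exp(-(e - i v) t) / (e - i v). *)
pose F t := - (expR (- (e * t)) *
  (e^-1 + (e * cos (t * v) - v * sin (t * v)) / (e ^+ 2 + v ^+ 2))).
have dF t : is_derive t 1 F (f t).
  rewrite /F /f; apply: is_derive_eq; rewrite /GRing.scale/=.
  by field; rewrite (lt0r_neq0 ev0) (lt0r_neq0 e0).
have cF t : F x @[x --> t] --> F t.
  by apply/differentiable_continuous/derivable1_diffP; have [] := dF t.
rewrite ge0_symfun_integralT.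
- rewrite EFinM; congr (_ * _)%E; rewrite -set_itvcy.
  transitivity (\int[mu]_(t in `[0%R, +oo[) (f t)%:E)%E.
    apply: eq_integral => t; rewrite inE/= in_itv/= => /andP[t0 _].
    by rewrite ger0_norm.
  rewrite (@ge0_continuous_FTC2y _ f F 0 0).
  + rewrite -EFinB /F mulr0 oppr0 expR0 mul0r cos0 sin0; congr EFin; field.
    by rewrite (lt0r_neq0 ev0) (lt0r_neq0 e0).
  + by move=> t _; rewrite mulr_ge0 ?expR_ge0.
  + exact: continuous_subspaceT.
  (* Bounds the bracket in [F], sine and cosine being at most 1 in absolute value. *)
  + pose K := e^-1 + (e + `|v|) / (e ^+ 2 + v ^+ 2).
    apply/norm_cvg0P.
    apply: (@squeeze_cvgr _ _ _ _ (cst 0) (fun t => expR (- (e * t)) * K)).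
    * apply: nearW => t; rewrite normr_ge0/= normrN normrM ger0_norm ?expR_ge0//.
      rewrite ler_wpM2l ?expR_ge0// (le_trans (ler_normD _ _))//.
      rewrite ger0_norm ?invr_ge0 ?(ltW e0)// lerD2l normrM normfV.
      rewrite (ger0_norm (ltW ev0)) ler_pM2r ?invr_gt0//.
      rewrite (le_trans (ler_normB _ _))// !normrM (ger0_norm (ltW e0)).
      by rewrite lerD// ler_piMr ?(ltW e0)// ?cos_max ?sin_max.
    * exact: cvg_cst.
    * rewrite -[X in _ --> X](mul0r K); apply: cvgM; last exact: cvg_cst.
      apply: (@cvg_comp _ _ _ (fun t => e * t) (fun t => expR (- t)) _ +oo).
        by apply: gt0_cvgMry.
      exact: cvgr_expR.
  + by move=> t _; have [] := dF t.
  + exact/cvg_at_right_filter/cF.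
  + by move=> t _; rewrite derive1E; have [_] := dF t.
- by move=> t; rewrite mulr_ge0 ?expR_ge0.
- move=> t; apply: cvgM; last exact: ccos.
  apply: (@cvg_comp _ _ _ (fun t => - (e * `|t|)) (@expR R) _
    (nbhs (- (e * `|t|)))); last exact: continuous_expR.
  apply: cvgN; apply: cvgM; first exact: cvg_cst.
  exact: norm_continuous.
- by move=> t /=; rewrite normrN mulNr cosN.
Qed.

Let continuous_expN_abs e : continuous (fun t => expR (- (e * `|t|))).
Proof.
move=> t; apply: (@cvg_comp _ _ _ (fun t => - (e * `|t|)) (@expR R) _
  (nbhs (- (e * `|t|)))); last exact: continuous_expR.
apply: cvgN; apply: cvgM; first exact: cvg_cst.
exact: norm_continuous.
Qed.

Lemma measurable_expN_abs e :
  measurable_fun [set: R] (fun t => expR (- (e * `|t|))).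
Proof. exact: continuous_measurable_fun. Qed.

(** The case v = 0 of the previous integral, where 1 + cos 0 = 2. *)
Lemma integral_expN_abs e : 0 < e ->
  (\int[mu]_t (expR (- (e * `|t|)))%:E = (2 / e)%:E)%E.
Proof.
move=> e0; have := integral_expN_1Dcos 0 e0.
under eq_integral do rewrite mulr0 cos0 mulrC EFinM.
rewrite ge0_integralZl//.
- rewrite expr0n addr0 => /(congr1 (fun x => 2^-1%:E * x)%E).
  rewrite muleA -!EFinM (_ : 2^-1 * (1 + 1) = 1) ?mul1e; last by lra.
  by move=> ->; congr EFin; field; rewrite lt0r_neq0.
- by apply/measurable_EFinP; exact: measurable_expN_abs.
Qed.

Lemma integrable_expN_abs e : 0 < e ->
  mu.-integrable [set: R] (fun t => (expR (- (e * `|t|)))%:E).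
Proof.
move=> e0; apply/integrableP; split.
  by apply/measurable_EFinP; exact: measurable_expN_abs.
under eq_integral do rewrite gee0_abs ?lee_fin ?expR_ge0//.
by rewrite integral_expN_abs// ltry.
Qed.

(** The value is 2 pi times the Poisson kernel of the half-plane. *)
Lemma Rintegral_expN_cos e v : 0 < e ->
  \int[mu]_t (expR (- (e * `|t|)) * cos (t * v)) = 2 * e / (e ^+ 2 + v ^+ 2).
Proof.
move=> e0.
have mc : measurable_fun [set: R] (fun t => cos (t * v)).
  apply: continuous_measurable_fun => t.
  apply: (@cvg_comp _ _ _ (fun t => t * v) (@cos R) _ (nbhs (t * v))).
    by apply: cvgM; [exact: cvg_id|exact: cvg_cst].
  exact: continuous_cos.
have ie := integrable_expN_abs e0.
have iec : mu.-integrable [set: R] (fun t => (expR (- (e * `|t|)) * cos (t * v))%:E).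
  apply: le_integrable ie => //.
    by apply/measurable_EFinP; apply: measurable_funM => //; exact: measurable_expN_abs.
  move=> t _; rewrite lee_fin normrM ler_piMr//; exact: cos_max.
have : \int[mu]_t (expR (- (e * `|t|)) * (1 + cos (t * v))) =
    2 * (e^-1 + e / (e ^+ 2 + v ^+ 2)).
  by rewrite /Rintegral integral_expN_1Dcos.
under eq_Rintegral do rewrite mulrDr mulr1.
rewrite RintegralD// [X in X + _]/Rintegral integral_expN_abs//=.
by rewrite mulrDr mulrA => /addrI.
Qed.

End exponential_kernel.

(** * Complex-valued integrals *)

Section complex_integrals.
Context {R : realType}.
Implicit Types z w : R[i].
Local Notation mu := (@lebesgue_measure R).

Lemma complex_ext z w :
  complex.Re z = complex.Re w -> complex.Im z = complex.Im w -> z = w.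
Proof. by case: z w => a b [c d] /= -> ->. Qed.

Lemma ReCM z w : complex.Re (z * w) =
  complex.Re z * complex.Re w - complex.Im z * complex.Im w.
Proof. by case: z w => ? ? []. Qed.

Lemma ImCM z w : complex.Im (z * w) =
  complex.Re z * complex.Im w + complex.Im z * complex.Re w.
Proof. by case: z w => ? ? []. Qed.

Lemma ReCD z w : complex.Re (z + w) = complex.Re z + complex.Re w.
Proof. by case: z w => ? ? []. Qed.

Lemma ImCD z w : complex.Im (z + w) = complex.Im z + complex.Im w.
Proof. by case: z w => ? ? []. Qed.

Lemma ReCN z : complex.Re (- z) = - complex.Re z.
Proof. by case: z. Qed.

Lemma ImCN z : complex.Im (- z) = - complex.Im z.
Proof. by case: z. Qed.

Lemma ReC1 : complex.Re (1 : R[i]) = 1. Proof. by []. Qed.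

Lemma ImC1 : complex.Im (1 : R[i]) = 0. Proof. by []. Qed.

Definition ReImCE := (ReCM, ImCM, ReCD, ImCD, ReCN, ImCN, ReC1, ImC1).

Lemma ReCZ z (x : R) : complex.Re (z * x%:C) = complex.Re z * x.
Proof. by rewrite ReCM mulr0 subr0. Qed.

Lemma ImCZ z (x : R) : complex.Im (z * x%:C) = complex.Im z * x.
Proof. by rewrite ImCM mulr0 add0r. Qed.

Lemma Re_expC z :
  complex.Re (expC z) = expR (complex.Re z) * cos (complex.Im z).
Proof. by rewrite /expC ReCM /= mul0r subr0. Qed.

Lemma Im_expC z :
  complex.Im (expC z) = expR (complex.Re z) * sin (complex.Im z).
Proof. by rewrite /expC ImCM /= mul0r addr0. Qed.

Lemma expCD z w : expC (z + w) = expC z * expC w.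
Proof.
apply: complex_ext.
  by rewrite [RHS]ReCM !Re_expC !Im_expC ReCD ImCD expRD cosD; ring.
by rewrite [RHS]ImCM !Re_expC !Im_expC ReCD ImCD expRD sinD; ring.
Qed.

Lemma expC_real (x : R) : expC x%:C = (expR x)%:C.
Proof.
by apply: complex_ext; rewrite ?Re_expC ?Im_expC/= ?cos0 ?sin0 ?mulr1 ?mulr0.
Qed.

(* The l^1 norm is enough for domination arguments: it is real-valued and
   submultiplicative. *)
Definition norm1 z : R := `|complex.Re z| + `|complex.Im z|.

Lemma norm1_ge0 z : 0 <= norm1 z. Proof. exact: addr_ge0. Qed.

Lemma normr_Re_le z : `|complex.Re z| <= norm1 z.
Proof. by rewrite lerDl. Qed.

Lemma normr_Im_le z : `|complex.Im z| <= norm1 z.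
Proof. by rewrite lerDr. Qed.

Lemma norm1M z w : norm1 (z * w) <= norm1 z * norm1 w.
Proof.
rewrite /norm1 ReCM ImCM mulrDl !mulrDr -!normrM.
have h1 := ler_normB (complex.Re z * complex.Re w) (complex.Im z * complex.Im w).
have h2 := ler_normD (complex.Re z * complex.Im w) (complex.Im z * complex.Re w).
lra.
Qed.

Lemma norm1_real (x : R) : norm1 x%:C = `|x|.
Proof. by rewrite /norm1/= normr0 addr0. Qed.

Lemma norm1_expC z : norm1 (expC z) <= 2 * expR (complex.Re z).
Proof.
rewrite /norm1 Re_expC Im_expC !normrM (ger0_norm (expR_ge0 _)).
rewrite -mulrDr mulrC ler_wpM2r ?expR_ge0//.
have := cos_max (complex.Im z); have := sin_max (complex.Im z); lra.
Qed.

Definition measurableC d (X : measurableType d) (f : X -> R[i]) :=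
  measurable_fun [set: X] (fun x => complex.Re (f x)) /\
  measurable_fun [set: X] (fun x => complex.Im (f x)).

Lemma measurableC_real d (X : measurableType d) (f : X -> R) :
  measurable_fun [set: X] f -> measurableC (fun x => (f x)%:C).
Proof. by move=> mf; split => //=; exact: measurable_cst. Qed.

Lemma measurableC_cst d (X : measurableType d) z :
  measurableC (fun _ : X => z).
Proof. by split; exact: measurable_cst. Qed.

Lemma measurableCM d (X : measurableType d) (f g : X -> R[i]) :
  measurableC f -> measurableC g -> measurableC (fun x => f x * g x).
Proof.
move=> [mf1 mf2] [mg1 mg2]; split.
  under eq_fun do rewrite ReCM.
  by apply: measurable_funB; exact: measurable_funM.
under eq_fun do rewrite ImCM.
by apply: measurable_funD; exact: measurable_funM.
Qed.

Lemma measurableCD d (X : measurableType d) (f g : X -> R[i]) :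
  measurableC f -> measurableC g -> measurableC (fun x => f x + g x).
Proof.
move=> [mf1 mf2] [mg1 mg2]; split.
  by under eq_fun do rewrite ReCD; exact: measurable_funD.
by under eq_fun do rewrite ImCD; exact: measurable_funD.
Qed.

Lemma measurableC_expC d (X : measurableType d) (f : X -> R[i]) :
  measurableC f -> measurableC (fun x => expC (f x)).
Proof.
move=> [mf1 mf2]; split.
  under eq_fun do rewrite Re_expC.
  apply: measurable_funM; first exact: measurableT_comp.
  by apply: measurableT_comp mf2; apply: continuous_measurable_fun; exact: continuous_cos.
under eq_fun do rewrite Im_expC.
apply: measurable_funM; first exact: measurableT_comp.
by apply: measurableT_comp mf2; apply: continuous_measurable_fun; exact: continuous_sin.
Qed.

Lemma measurableC_comp d d' (X : measurableType d) (Y : measurableType d')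
    (f : Y -> R[i]) (g : X -> Y) :
  measurableC f -> measurable_fun setT g -> measurableC (fun x => f (g x)).
Proof.
move=> [mf1 mf2] mg; split; first exact: (measurableT_comp mf1 mg).
exact: (measurableT_comp mf2 mg).
Qed.

Lemma measurableC_line (sigma : R) : measurableC (fun t => sigma +i* t).
Proof. by split => /=; [exact: measurable_cst|exact: measurable_id]. Qed.

Definition integrableC (f : R -> R[i]) :=
  mu.-integrable [set: R] (fun x => (complex.Re (f x))%:E) /\
  mu.-integrable [set: R] (fun x => (complex.Im (f x))%:E).

Lemma le_integrableC (f : R -> R[i]) (g : R -> R) : measurableC f ->
  mu.-integrable [set: R] (fun x => (g x)%:E) ->
  (forall x, norm1 (f x) <= g x) -> integrableC f.
Proof.
move=> [mf1 mf2] ig fg; split; apply: le_integrable ig => //.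
- exact/measurable_EFinP.
- move=> x _; rewrite lee_fin (le_trans (normr_Re_le _))//.
  by rewrite (le_trans (fg x)) ?ler_norm.
- exact/measurable_EFinP.
- move=> x _; rewrite lee_fin (le_trans (normr_Im_le _))//.
  by rewrite (le_trans (fg x)) ?ler_norm.
Qed.

(** The factor 2 accounts for the real and imaginary parts, each bounded by the integral of [g]. *)
Lemma norm1_integralC_le (f : R -> R[i]) (g : R -> R) : integrableC f ->
  mu.-integrable [set: R] (fun x => (g x)%:E) ->
  (forall x, norm1 (f x) <= g x) ->
  norm1 (integralC setT f) <= 2 * \int[mu]_x g x.
Proof.
move=> [if1 if2] ig fg.
have bound (h : R -> R) : mu.-integrable [set: R] (fun x => (h x)%:E) ->
    (forall x, `|h x| <= g x) -> `|\int[mu]_x h x| <= \int[mu]_x g x.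
  move=> ih hg; apply: (le_trans (le_normr_Rintegral _ ih)) => //.
  apply: le_Rintegral => //; exact: integrable_norm.
rewrite mulr_natl mulr2n; apply: lerD; apply: bound => // x.
  exact: le_trans (normr_Re_le _) (fg x).
exact: le_trans (normr_Im_le _) (fg x).
Qed.

Lemma integralCZ z (f : R -> R[i]) : integrableC f ->
  integralC setT (fun x => z * f x) = z * integralC setT f.
Proof.
move=> [if1 if2]; have iZ c (g : R -> R) :
    mu.-integrable [set: R] (fun x => (g x)%:E) ->
    mu.-integrable [set: R] (fun x => (c * g x)%:E).
  by move=> ig; under eq_fun do rewrite EFinM; exact: integrableZl.
apply: complex_ext; rewrite ReImCE /=.
  under eq_Rintegral do rewrite ReCM.
  by rewrite RintegralB ?RintegralZl//; exact: iZ.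
under eq_Rintegral do rewrite ImCM.
by rewrite RintegralD ?RintegralZl//; exact: iZ.
Qed.

Lemma integralCZr z (f : R -> R[i]) : integrableC f ->
  integralC setT (fun x => f x * z) = integralC setT f * z.
Proof.
by move=> fi; under eq_fun do rewrite mulrC; rewrite integralCZ // mulrC.
Qed.

Lemma integrableCZ z (f : R -> R[i]) :
  integrableC f -> integrableC (fun x => z * f x).
Proof.
move=> [if1 if2]; have iZ c (g : R -> R) :
    mu.-integrable [set: R] (fun x => (g x)%:E) ->
    mu.-integrable [set: R] (fun x => (c * g x)%:E).
  by move=> ig; under eq_fun do rewrite EFinM; exact: integrableZl.
split.
  under eq_fun do rewrite ReCM EFinB.
  by apply: integrableB => //; exact: iZ.
under eq_fun do rewrite ImCM EFinD.
by apply: integrableD => //; exact: iZ.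
Qed.

Lemma integralCB (f g : R -> R[i]) : integrableC f -> integrableC g ->
  integralC setT (fun x => f x - g x) = integralC setT f - integralC setT g.
Proof.
move=> [if1 if2] [ig1 ig2]; apply: complex_ext; rewrite !ReImCE /=.
  by under eq_Rintegral do rewrite !ReImCE; rewrite RintegralB.
by under eq_Rintegral do rewrite !ReImCE; rewrite RintegralB.
Qed.

Lemma integralC_real (f : R -> R) :
  integralC setT (fun x => (f x)%:C) = (\int[mu]_x f x)%:C.
Proof. by apply: complex_ext; rewrite //= Rintegral_cst// mul0r. Qed.

(** In Fubini's theorem the inner integrals are extended reals, finite only almost everywhere;
    [fine] alters the infinite ones, but only on a null set. *)
Lemma Rintegral_Fubini (f : R * R -> R) :
  (mu \x mu)%E.-integrable [set: R * R] (fun p => (f p)%:E) ->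
  \int[mu]_x \int[mu]_y f (x, y) = \int[mu]_y \int[mu]_x f (x, y).
Proof.
move=> fi.
have := Fubini fi.
have mf : measurable_fun [set: R * R] (fun p => (f p)%:E).
  exact: measurable_int fi.
have h1 : (\int[mu]_x \int[mu]_y (f (x, y))%:E =
    \int[mu]_x (\int[mu]_y f (x, y))%R%:E)%E.
  apply: ae_eq_integral => //.
  - exact: measurable_fubini_F fi.
  - apply/measurable_EFinP; apply: measurableT_comp; first exact: fine_measurable.
    exact: measurable_fubini_F fi.
  - apply: filterS (ae_integrable1 fi) => x /= ix _.
    by rewrite fineK//; exact: integrable_fin_num.
have h2 : (\int[mu]_y \int[mu]_x (f (x, y))%:E =
    \int[mu]_y (\int[mu]_x f (x, y))%R%:E)%E.
  apply: ae_eq_integral => //.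
  - exact: measurable_fubini_G fi.
  - apply/measurable_EFinP; apply: measurableT_comp; first exact: fine_measurable.
    exact: measurable_fubini_G fi.
  - apply: filterS (ae_integrable2 fi) => y /= iy _.
    by rewrite fineK//; exact: integrable_fin_num.
by rewrite h1 h2 => /(congr1 fine).
Qed.

Lemma integralC_Fubini (f : R * R -> R[i]) (g : R * R -> R) :
  measurableC f ->
  (mu \x mu)%E.-integrable [set: R * R] (fun p => (g p)%:E) ->
  (forall p, norm1 (f p) <= g p) ->
  integralC setT (fun x => integralC setT (fun y => f (x, y))) =
  integralC setT (fun y => integralC setT (fun x => f (x, y))).
Proof.
move=> [mf1 mf2] ig fg; apply: complex_ext => /=.
  apply: (Rintegral_Fubini (f := fun p => complex.Re (f p))).
  apply: le_integrable ig => //; first exact/measurable_EFinP.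
  move=> p _; rewrite lee_fin (le_trans (normr_Re_le _))//.
  by rewrite (le_trans (fg p)) ?ler_norm.
apply: (Rintegral_Fubini (f := fun p => complex.Im (f p))).
apply: le_integrable ig => //; first exact/measurable_EFinP.
move=> p _; rewrite lee_fin (le_trans (normr_Im_le _))//.
by rewrite (le_trans (fg p)) ?ler_norm.
Qed.

(** Supplies the majorants of product form used when integrals are exchanged. *)
Lemma integrable_prod (a b : R -> R) :
  mu.-integrable [set: R] (fun x => (a x)%:E) ->
  mu.-integrable [set: R] (fun x => (b x)%:E) ->
  (mu \x mu)%E.-integrable [set: R * R] (fun p => (a p.1 * b p.2)%:E).
Proof.
move=> ia ib.
have ma : measurable_fun [set: R] a by apply/measurable_EFinP; exact: measurable_int ia.
have mb : measurable_fun [set: R] b by apply/measurable_EFinP; exact: measurable_int ib.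
apply/integrable12ltyP => /=.
  apply/measurable_EFinP; apply: measurable_funM.
    exact: measurableT_comp.
  exact: measurableT_comp.
have /integrableP[_ bfin] := ib; have /integrableP[_ afin] := ia.
have b0 : (0 <= \int[mu]_y `|(b y)%:E|)%E by exact: integral_ge0.
have -> : (\int[mu]_x \int[mu]_y `|(a x * b y)%:E| =
    \int[mu]_x (`|(a x)%:E| * \int[mu]_y `|(b y)%:E|))%E.
  apply: eq_integral => x _; rewrite -ge0_integralZl//; last first.
    by apply: measurableT_comp => //; exact/measurable_EFinP.
  by apply: eq_integral => y _; rewrite -abseM.
rewrite ge0_integralZr//; last first.
  by apply: measurableT_comp => //; exact/measurable_EFinP.
by rewrite lte_mul_pinfty// ?ge0_fin_numE//; exact: integral_ge0.
Qed.

End complex_integrals.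

(** * Inversion of the cosine transform *)

Section translation_inversion.
Context {R : realType}.
Local Notation mu := (@lebesgue_measure R).

Lemma ge0_integral_affine (a b : R) (f : R -> R) : 0 < a -> continuous f ->
  (forall x, 0 <= f x) ->
  (\int[mu]_x (f x)%:E = \int[mu]_x (f (a * x + b) * a)%:E)%E.
Proof.
move=> a0 cf f0.
pose F (x : R) := a * x + b.
have dF (x : R) : is_derive x 1 F a.
  by rewrite /F; apply: is_derive_eq; rewrite /GRing.scale/= mulr1 addr0.
have F'E : derive1 F = fun _ => a.
  by apply/funext => x; rewrite derive1E; have [_] := dF x.
rewrite (@increasing_ge0_integration_by_substitutionT _ F f) //.
- by apply: eq_integral => x _; rewrite F'E.
- by move=> x y xy; rewrite ltrD2r ltr_pM2l.
- by rewrite F'E => x; exact: cvg_cst.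
- by rewrite F'E; exact: is_cvg_cst.
- by rewrite F'E; exact: is_cvg_cst.
- apply/cvgNry; rewrite /F.
  apply/cvgryPge => A; near=> x.
  rewrite /= fctE opprD lerBrDr -mulrN mulrC -ler_pdivrMr// lerNr.
  by near: x; apply: nbhs_ninfty_le; exact: num_real.
- apply/cvgryPge => A; near=> x.
  rewrite /F -lerBlDr mulrC -ler_pdivrMr//.
Unshelve. all: by end_near. Qed.

Lemma integral_shift (b : R) (f : R -> R) : continuous f ->
  \int[mu]_x f x = \int[mu]_x f (x + b).
Proof.
move=> cf; congr fine; rewrite integralE [RHS]integralE.
have cmax (g : R -> R) : continuous g -> continuous (fun x => Num.max (g x) 0).
  by move=> cg x; exact: (continuous_max (cg x) (@cst_continuous _ _ (0 : R) x)).
congr (_ - _)%E.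
- transitivity (\int[mu]_x (Num.max (f x) 0)%:E)%E.
    by apply: eq_integral => x _; rewrite funeposE -EFin_max.
  rewrite (@ge0_integral_affine 1 b)//.
  + by apply: eq_integral => x _; rewrite funeposE -EFin_max mulr1 mul1r.
  + exact: cmax.
  + by move=> x; rewrite le_max lexx orbT.
- transitivity (\int[mu]_x (Num.max (- f x) 0)%:E)%E.
    by apply: eq_integral => x _; rewrite funenegE -EFinN -EFin_max.
  rewrite (@ge0_integral_affine 1 b)//.
  + by apply: eq_integral => x _; rewrite funenegE -EFinN -EFin_max mulr1 mul1r.
  + by apply: cmax => x; apply: cvgN; exact: cf.
  + by move=> x; rewrite le_max lexx orbT.
Qed.

Let oneDsqr_gt0 (x : R) : 0 < 1 + x ^+ 2.
Proof. by rewrite ltr_pwDl ?sqr_ge0. Qed.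

Let continuous_cauchy : continuous (fun x : R => (1 + x ^+ 2)^-1).
Proof. exact: continuous_oneDsqrV. Qed.

Lemma integral_cauchy : (\int[mu]_x ((1 + x ^+ 2)^-1)%:E = pi%:E)%E.
Proof.
rewrite ge0_symfun_integralT.
- rewrite -set_itvcy integral0y_oneDsqr -EFinM; congr EFin.
  by field.
- by move=> x; rewrite invr_ge0 ltW.
- exact: continuous_cauchy.
- by move=> x /=; rewrite sqrrN.
Qed.

Lemma integrable_cauchy :
  mu.-integrable [set: R] (fun x => ((1 + x ^+ 2)^-1)%:E).
Proof.
apply/integrableP; split.
  by apply/measurable_EFinP; exact: continuous_measurable_fun.
under eq_integral do rewrite gee0_abs ?lee_fin ?invr_ge0 ?ltW//.
by rewrite integral_cauchy ltry.
Qed.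

(** A sequence of Abel parameters, since dominated convergence is applied along sequences. *)
Let eps (n : nat) : R := n.+1%:R^-1.

Let eps_gt0 n : 0 < eps n. Proof. by rewrite invr_gt0. Qed.

Let cvg_eps : eps n @[n --> \oo] --> 0.
Proof. exact: cvg_harmonic. Qed.

(* Abel summation of the cosine integral: the kernel [expR (- (e * `|t|))]
   turns it into an average of [h] against the Poisson kernel. *)
Lemma Abel_cosine_transform (h : R -> R) (M e : R) : 0 < e ->
  continuous h -> (forall x, 0 <= h x <= M) ->
  mu.-integrable [set: R] (fun x => (h x)%:E) ->
  \int[mu]_t (expR (- (e * `|t|)) * \int[mu]_v (h v * cos (t * v))) =
  2 * \int[mu]_y (h (e * y) / (1 + y ^+ 2)).
Proof.
move=> e0 ch hM ih; have h0 x : 0 <= h x by have /andP[] := hM x.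
have mh := continuous_measurable_fun ch.
have mcos : measurable_fun [set: R * R] (fun p : R * R => cos (p.1 * p.2)).
  apply: measurableT_comp; first by apply: continuous_measurable_fun; exact: continuous_cos.
  by apply: measurable_funM; [exact: measurable_fst|exact: measurable_snd].
pose f (p : R * R) := expR (- (e * `|p.1|)) * (h p.2 * cos (p.1 * p.2)).
have mE : measurable_fun [set: R * R] (fun p : R * R => expR (- (e * `|p.1|))).
  by apply: (measurableT_comp (measurable_expN_abs e)); exact: measurable_fst.
have mh2 : measurable_fun [set: R * R] (fun p : R * R => h p.2).
  by apply: (measurableT_comp mh); exact: measurable_snd.
have icos t : mu.-integrable [set: R] (fun v => (h v * cos (t * v))%:E).
  apply: le_integrable ih => //.
    apply/measurable_EFinP; apply: measurable_funM => //.
    apply: measurableT_comp; first by apply: continuous_measurable_fun; exact: continuous_cos.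
    by apply: measurable_funM.
  by move=> v _; rewrite lee_fin normrM ler_piMr// cos_max.
transitivity (\int[mu]_t \int[mu]_v f (t, v)).
  by apply: eq_Rintegral => t _; rewrite -(RintegralZl _ measurableT (icos t)).
(* The factor exp(-e |t|) is what makes the integrand integrable on the plane. *)
rewrite Rintegral_Fubini; last first.
  apply: le_integrable (integrable_prod (integrable_expN_abs e0) ih) => //.
    apply/measurable_EFinP; apply: measurable_funM => //.
    exact: measurable_funM.
  by move=> p _; rewrite lee_fin !normrM ler_wpM2l// ler_piMr// cos_max.
(* The inner integral over t is the cosine transform of the exponential kernel. *)
transitivity (\int[mu]_v (h v * (2 * e / (e ^+ 2 + v ^+ 2)))).
  apply: eq_Rintegral => v _; rewrite -Rintegral_expN_cos// -RintegralZl//.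
    by apply: eq_Rintegral => t _; rewrite /f/=; ring.
  apply: le_integrable (integrable_expN_abs e0) => //.
    apply/measurable_EFinP; apply: measurable_funM; first exact: measurable_expN_abs.
    apply: measurableT_comp; first by apply: continuous_measurable_fun; exact: continuous_cos.
    by apply: measurable_funM.
  by move=> t _; rewrite lee_fin normrM ler_piMr// cos_max.
have ev0 (v : R) : 0 < e ^+ 2 + v ^+ 2 by rewrite ltr_pwDl ?exprn_gt0 ?sqr_ge0.
have cP : continuous (fun v : R => h v * (2 * e / (e ^+ 2 + v ^+ 2))).
  move=> v; apply: cvgM; first exact: ch.
  apply: cvgM; first exact: cvg_cst.
  apply: cvgV; first by rewrite lt0r_neq0.
  by apply: cvgD; [exact: cvg_cst|apply: exprn_continuous].
(* Rescaling v = e y moves the parameter from the kernel into [h], ready for the limit e -> 0. *)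
have -> : \int[mu]_v (h v * (2 * e / (e ^+ 2 + v ^+ 2))) =
    \int[mu]_y (2 * (h (e * y) / (1 + y ^+ 2))).
  congr fine; rewrite (@ge0_integral_affine e 0)//.
    apply: eq_integral => y _; rewrite addr0; congr EFin.
    by field; rewrite !lt0r_neq0.
  by move=> v; rewrite mulr_ge0// mulr_ge0 ?invr_ge0 ?ltW// mulr_gt0.
rewrite RintegralZl//.
apply: le_integrable (integrableZl measurableT M integrable_cauchy) => //.
  apply/measurable_EFinP; apply: measurable_funM; last first.
    by apply: continuous_measurable_fun; exact: continuous_cauchy.
  by apply: (measurableT_comp mh); exact: measurable_funM.
move=> y _; rewrite -EFinM lee_fin !normrM ler_wpM2r//.
by rewrite ger0_norm// (le_trans _ (ler_norm _))//; have /andP[] := hM (e * y).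
Qed.

(** Let e -> 0 in the Abel-summed identity. On the left the transform itself dominates, hence the
    assumption that it is integrable; on the right h (e y) tends to h 0 under the majorant M / (1 +
    y^2). The total mass pi of the Cauchy kernel gives the constant. *)
Lemma cosine_inversion (h : R -> R) (M : R) :
  continuous h -> (forall x, 0 <= h x <= M) ->
  mu.-integrable [set: R] (fun x => (h x)%:E) ->
  mu.-integrable [set: R] (fun t => (\int[mu]_v (h v * cos (t * v)))%:E) ->
  \int[mu]_t \int[mu]_v (h v * cos (t * v)) = 2 * pi * h 0.
Proof.
move=> ch hM ih iC; pose C t := \int[mu]_v (h v * cos (t * v)).
have h0 x : 0 <= h x by have /andP[] := hM x.
have mh := continuous_measurable_fun ch.
have mC : measurable_fun [set: R] C.
  by apply/measurable_EFinP; exact: measurable_int iC.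
have cvg0 (t : R) : eps n * t @[n --> \oo] --> (0 : R).
  by rewrite -[X in _ --> X](mul0r t); apply: cvgM; [exact: cvg_eps|exact: cvg_cst].
have lhs : (\int[mu]_t (expR (- (eps n * `|t|)) * C t)%:E)%E @[n --> \oo] -->
    (\int[mu]_t (C t)%:E)%E.
  apply: (@dominated_cvg _ (measurableTypeR R) _ mu setT measurableT
    (fun n t => (expR (- (eps n * `|t|)) * C t)%:E) _ (fun t => `|(C t)%:E|%E)).
  - move=> n; apply/measurable_EFinP; apply: measurable_funM => //.
    exact: measurable_expN_abs.
  - move=> t _; apply/cvg_EFin; first exact: nearW.
    rewrite -[X in _ --> X]mul1r; apply: cvgM; last exact: cvg_cst.
    rewrite -expR0.
    apply: (@cvg_comp _ _ _ (fun n => - (eps n * `|t|)) (@expR R) _ (nbhs (0 : R))).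
      by have := cvgN (cvg0 `|t|); rewrite oppr0; exact.
    exact: continuous_expR.
  - by [].
  - exact: integrable_abse.
  - move=> n t _; rewrite lee_fin normrM ler_piMl// ger0_norm ?expR_ge0//.
    by rewrite -expR0 ler_expR oppr_le0 mulr_ge0// ltW.
have rhs : (\int[mu]_y (h (eps n * y) / (1 + y ^+ 2))%:E)%E @[n --> \oo] -->
    (\int[mu]_y (h 0%R / (1 + y ^+ 2))%:E)%E.
  apply: (@dominated_cvg _ (measurableTypeR R) _ mu setT measurableT
    (fun n y => (h (eps n * y) / (1 + y ^+ 2))%:E) _
    (fun y => (M%:E * ((1 + y ^+ 2)^-1)%:E)%E)).
  - move=> n; apply/measurable_EFinP; apply: measurable_funM.
      by apply: (measurableT_comp mh); exact: measurable_funM.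
    by apply: continuous_measurable_fun; exact: continuous_cauchy.
  - move=> y _; apply/cvg_EFin; first exact: nearW.
    apply: cvgM; last exact: cvg_cst.
    by apply: (@cvg_comp _ _ _ (fun n => eps n * y) h _ (nbhs (0 : R)));
      [exact: cvg0|exact: ch].
  - by [].
  - by apply: integrableZl => //; exact: integrable_cauchy.
  - move=> n y _; rewrite -EFinM lee_fin ger0_norm.
      by rewrite ler_wpM2r ?invr_ge0 ?(ltW (oneDsqr_gt0 _))//; have /andP[] := hM (eps n * y).
    by rewrite divr_ge0 ?(ltW (oneDsqr_gt0 _)).
have ifin (f : R -> R) : mu.-integrable [set: R] (fun x => (f x)%:E) ->
    (\int[mu]_x (f x)%:E = (\int[mu]_x f x)%R%:E)%E.
  by move=> fi; rewrite fineK//; exact: integrable_fin_num.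
have -> : 2 * pi * h 0 = 2 * \int[mu]_y (h 0 / (1 + y ^+ 2)).
  rewrite RintegralZl//; last exact: integrable_cauchy.
  by rewrite [Rintegral _ _ _]/Rintegral integral_cauchy/=; ring.
have lhsR : \int[mu]_t (expR (- (eps n * `|t|)) * C t) @[n --> \oo] --> \int[mu]_t C t.
  by apply: fine_cvg; rewrite -ifin.
have rhsR : \int[mu]_y (h (eps n * y) / (1 + y ^+ 2)) @[n --> \oo] -->
    \int[mu]_y (h 0 / (1 + y ^+ 2)).
  apply: fine_cvg; rewrite -ifin//.
  under eq_fun do rewrite EFinM; apply: integrableZl => //; exact: integrable_cauchy.
have /cvg_lim <- // := lhsR.
apply/cvg_lim => //; under eq_fun do rewrite (Abel_cosine_transform (eps_gt0 _) ch hM ih).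
by apply: cvgM; [exact: cvg_cst|exact: rhsR].
Qed.

End translation_inversion.

(** * Euler's Gamma function *)

Section gamma_function.
Context {R : realType}.
Implicit Types (z : R[i]) (a m w : R).
Local Notation mu := (@lebesgue_measure R).

(** Reflection preserves Lebesgue measure and exchanges the positive and negative parts. *)
Lemma Rintegral_odd (f : R -> R) : measurable_fun [set: R] f ->
  (forall x, f (- x) = - f x) -> \int[mu]_x f x = 0.
Proof.
move=> mf oddf; rewrite /Rintegral integralE.
have -> : (\int[mu]_x (EFin \o f)^\+ x = \int[mu]_x (EFin \o f)^\- x)%E.
  have mfp : measurable_fun [set: R] (EFin \o f)^\+%E.
    by apply: measurable_funepos; exact/measurable_EFinP.
  transitivity (\int[pushforward mu (-%R : _ -> measurableTypeR R)]_x
      (EFin \o f)^\+ x)%E.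
    by apply: eq_measure_integral => //= A mA _; exact/esym/lebesgue_measureN.
  rewrite ge0_integral_pushforward//= preimage_setT.
  by apply: eq_integral => x _; rewrite /= funeposE funenegE /= oddf.
(* If the common value is infinite, so is the difference, and [fine] sends it to 0. *)
by case: integral => [r| |] //=; rewrite subrr.
Qed.

Lemma continuous_comp_fun (f g : R -> R) :
  continuous f -> continuous g -> continuous (fun x => g (f x)).
Proof. by move=> cf cg x; exact: (cvg_comp _ _ (cf x) (cg (f x))). Qed.

Lemma cvg_expRN_mul m : 0 < m -> expR (- (m * n%:R)) @[n --> \oo] --> 0.
Proof.
move=> m0; rewrite (_ : (fun n => _) = fun n => expR (- m) ^+ n).
  by apply: cvg_expr; rewrite ger0_norm ?expR_ge0// -expR0 ltr_expR oppr_lt0.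
by apply/funext => n; rewrite -expRM_natr mulNr.
Qed.

(** With w = ln t and a = Re z, this is the modulus of Euler's integrand (Jacobian included): it
    decays like e^(a w) on the left and doubly exponentially on the right. A two-sided exponential
    bound is enough for integrability and for the boundary terms. *)
Lemma expR_sub_expR_le a : 0 < a -> exists K m : R,
  [/\ 0 <= K, 0 < m & forall w, expR (a * w - expR w) <= K * expR (- (m * `|w|))].
Proof.
move=> a0; pose c := ln (a + 1).
have ec : expR c = a + 1 by rewrite lnK// posrE addr_gt0.
(* The tangent to the exponential at [c] has slope [a + 1]. *)
have tangent w : (a + 1) * (1 + (w - c)) <= expR w.
  rewrite -ec -[in leRHS](subrK c w) [in leRHS]addrC expRD.
  by rewrite ler_wpM2l ?expR_ge0// expR_ge1Dx.
(* The tangent is w -> (a + 1) w + D, so a w - e^w <= - w - D: rate 1 on the right, against rate a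
   on the left. *)
pose D := (a + 1) * (1 - c).
exists (1 + expR (- D)), (Num.min a 1).
have m0 : 0 < Num.min a 1 by rewrite lt_min a0 ltr01.
have ma : Num.min a 1 <= a by rewrite ge_min lexx.
have m1 : Num.min a 1 <= 1 by rewrite ge_min lexx orbT.
split => [|//|w]; first by rewrite addr_ge0 ?expR_ge0.
rewrite mulrDl mul1r; have [w0|w0] := leP 0 w.
  rewrite ler_wpDl ?expR_ge0// -expRD ler_expR ger0_norm//.
  have := tangent w; rewrite (_ : (a + 1) * (1 + (w - c)) = a * w + w + D).
    have := ler_wpM2r w0 m1; lra.
  by rewrite /D; ring.
rewrite ler_wpDr ?mulr_ge0 ?expR_ge0// ler_expR ltr0_norm// mulrN opprK.
have := ler_wnM2r (ltW w0) ma; have := expR_ge0 w; lra.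
Qed.

Lemma measurable_expR_sub_expR a :
  measurable_fun [set: R] (fun w => expR (a * w - expR w)).
Proof.
apply: measurableT_comp => //; apply: measurable_funB; first exact: measurable_funM.
exact: measurable_expR.
Qed.

Lemma integrable_expR_sub_expR a : 0 < a ->
  mu.-integrable [set: R] (fun w => (expR (a * w - expR w))%:E).
Proof.
move=> /expR_sub_expR_le[K [m [K0 m0 Km]]].
apply: le_integrable (integrableZl measurableT K (integrable_expN_abs m0)) => //.
  by apply/measurable_EFinP; exact: measurable_expR_sub_expR.
move=> w _; rewrite -EFinM lee_fin ger0_norm ?expR_ge0//.
by rewrite (le_trans (Km w)) ?ler_norm.
Qed.

Definition continuousC (f : R -> R[i]) :=
  continuous (fun x => complex.Re (f x)) /\ continuous (fun x => complex.Im (f x)).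

Lemma continuousC_measurable (f : R -> R[i]) : continuousC f -> measurableC f.
Proof. by move=> [cf1 cf2]; split; exact: continuous_measurable_fun. Qed.

Lemma continuousC_real (f : R -> R) : continuous f -> continuousC (fun x => (f x)%:C).
Proof. by move=> cf; split => //= x; exact: cvg_cst. Qed.

Lemma continuousCM (f g : R -> R[i]) :
  continuousC f -> continuousC g -> continuousC (fun x => f x * g x).
Proof.
move=> [cf1 cf2] [cg1 cg2]; split.
  under eq_fun do rewrite ReCM; move=> x.
  by apply: cvgB; apply: cvgM; [exact: cf1|exact: cg1|exact: cf2|exact: cg2].
under eq_fun do rewrite ImCM; move=> x.
by apply: cvgD; apply: cvgM; [exact: cf1|exact: cg2|exact: cf2|exact: cg1].
Qed.

Lemma continuousC_expC z : continuousC (fun w => expC (z * w%:C)).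
Proof.
have cM (b : R) : continuous (fun w : R => b * w).
  by move=> w; apply: cvgM; [exact: cvg_cst|exact: cvg_id].
split.
  under eq_fun do rewrite Re_expC ReCZ ImCZ; move=> x.
  apply: cvgM.
    exact: (continuous_comp_fun (cM (complex.Re z)) (@continuous_expR R)).
  exact: (continuous_comp_fun (cM (complex.Im z)) (@continuous_cos R)).
under eq_fun do rewrite Im_expC ReCZ ImCZ; move=> x.
apply: cvgM.
  exact: (continuous_comp_fun (cM (complex.Re z)) (@continuous_expR R)).
exact: (continuous_comp_fun (cM (complex.Im z)) (@continuous_sin R)).
Qed.

Lemma integralC_shift a (f : R -> R[i]) : continuousC f ->
  integralC setT f = integralC setT (fun x => f (x + a)).
Proof.
move=> [cf1 cf2]; apply: complex_ext => /=; first exact: (integral_shift a cf1).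
exact: (integral_shift a cf2).
Qed.

(* Euler's integrand after the substitution [t = expR w]. *)
Definition Gamma_kernel z w : R[i] := expC (z * w%:C) * (expR (- expR w))%:C.

Let continuous_expN_expR : continuous (fun w : R => expR (- expR w)).
Proof.
move=> w; apply: (@cvg_comp _ _ _ (fun w => - expR w) (@expR R) _ (nbhs (- expR w))).
  by apply: cvgN; exact: continuous_expR.
exact: continuous_expR.
Qed.

Lemma continuousC_Gamma_kernel z : continuousC (Gamma_kernel z).
Proof. by apply: continuousCM; [exact: continuousC_expC|exact: continuousC_real]. Qed.

Lemma norm1_Gamma_kernel z w :
  norm1 (Gamma_kernel z w) <= 2 * expR (complex.Re z * w - expR w).
Proof.
rewrite (le_trans (norm1M _ _))// norm1_real ger0_norm ?expR_ge0// expRD mulrA.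
by rewrite ler_wpM2r ?expR_ge0// (le_trans (norm1_expC _))// ReCZ.
Qed.

Let integrable_majorant z : 0 < complex.Re z ->
  mu.-integrable [set: R] (fun w => (2 * expR (complex.Re z * w - expR w))%:E).
Proof.
move=> z0; under eq_fun do rewrite EFinM.
by apply: integrableZl => //; exact: integrable_expR_sub_expR.
Qed.

Lemma integrableC_Gamma_kernel z : 0 < complex.Re z ->
  integrableC (Gamma_kernel z).
Proof.
move=> z0; apply: (le_integrableC _ (integrable_majorant z0)).
  by apply: continuousC_measurable; exact: continuousC_Gamma_kernel.
exact: norm1_Gamma_kernel.
Qed.

(** The Jacobian e^w of t = e^w turns the exponent z - 1 into z. *)
Lemma GammaCE z : GammaC z = integralC setT (Gamma_kernel z).
Proof.
have cln (b : R) : {in `]0, +oo[, continuous (fun t : R => b * ln t)}.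
  move=> t; rewrite in_itv/= andbT => t0.
  by apply: cvgM; [exact: cvg_cst|exact: continuous_ln].
have cE : continuous (fun t : R => expR (- t)).
  move=> t; apply: (@cvg_comp _ _ _ (fun w => - w) (@expR R) _ (nbhs (- t))).
    by apply: cvgN; exact: cvg_id.
  exact: continuous_expR.
have cosE : {in `]0, +oo[, continuous (fun t : R =>
    expR ((complex.Re z - 1) * ln t) * cos (complex.Im z * ln t) * expR (- t))}.
  move=> t t0; apply: cvgM; last exact: cE.
  apply: cvgM.
    exact: (cvg_comp _ _ (cln (complex.Re z - 1) t t0) (@continuous_expR R _)).
  exact: (cvg_comp _ _ (cln (complex.Im z) t t0) (@continuous_cos R _)).
have sinE : {in `]0, +oo[, continuous (fun t : R =>
    expR ((complex.Re z - 1) * ln t) * sin (complex.Im z * ln t) * expR (- t))}.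
  move=> t t0; apply: cvgM; last exact: cE.
  apply: cvgM.
    exact: (cvg_comp _ _ (cln (complex.Re z - 1) t t0) (@continuous_expR R _)).
  exact: (cvg_comp _ _ (cln (complex.Im z) t t0) (@continuous_sin R _)).
have expRB1 w : expR ((complex.Re z - 1) * w) * expR w = expR (complex.Re z * w).
  by rewrite -expRD; congr expR; ring.
rewrite /GammaC /integralC /Rintegral; congr (fine _ +i* fine _).
  under eq_integral do rewrite ReCZ /cpow Re_expC ReCZ ImCZ ReCD ImCD ReCN ImCN /= subr0.
  rewrite (integration_by_substitution_expR cosE); apply: eq_integral => w _.
  by rewrite expRK /Gamma_kernel ReCZ Re_expC ReCZ ImCZ -expRB1; congr EFin; ring.
under eq_integral do rewrite ImCZ /cpow Im_expC ReCZ ImCZ ReCD ImCD ReCN ImCN /= subr0.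
rewrite (integration_by_substitution_expR sinE); apply: eq_integral => w _.
by rewrite expRK /Gamma_kernel ImCZ Im_expC ReCZ ImCZ -expRB1; congr EFin; ring.
Qed.

(** Integration by parts: with K_z = e^(z w - e^w), the difference z K_z - K_(z+1) is the derivative
    of K_z in w, and K_z vanishes at both ends of the line. *)
Lemma GammaCD1 z : 0 < complex.Re z -> GammaC (z + 1) = z * GammaC z.
Proof.
move=> z0; have z10 : 0 < complex.Re (z + 1) by rewrite ReCD addr_gt0.
apply/esym/eqP; rewrite -subr_eq0 !GammaCE -integralCZ; last first.
  exact: integrableC_Gamma_kernel.
have iG := integrableC_Gamma_kernel z0; have iG1 := integrableC_Gamma_kernel z10.
rewrite -integralCB//; last exact: integrableCZ.
set D := fun w => z * Gamma_kernel z w - Gamma_kernel (z + 1) w.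
have cG := continuousC_Gamma_kernel z; have cG1 := continuousC_Gamma_kernel (z + 1).
have iD : integrableC D.
  have [i1 i2] := integrableCZ z iG; have [i3 i4] := iG1.
  split; under eq_fun do rewrite !(ReCD, ImCD, ReCN, ImCN) EFinB; exact: integrableB.
have cD : continuousC D.
  have cz : continuousC (fun _ => z) by split=> x; exact: cvg_cst.
  have [c1 c2] := continuousCM cz cG; have [c3 c4] := cG1.
  split; under eq_fun do rewrite !(ReCD, ImCD, ReCN, ImCN); move=> x.
    by apply: cvgB; [exact: c1|exact: c3].
  by apply: cvgB; [exact: c2|exact: c4].
(* Boundary terms, stated for any real function below [norm1] of the kernel so as to serve the real
   and the imaginary part. *)
have G0 (f : R -> R) : (forall w, `|f w| <= norm1 (Gamma_kernel z w)) ->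
    f n%:R @[n --> \oo] --> 0 /\ f (- n%:R) @[n --> \oo] --> 0.
  move=> fG; have [K [m [K0 m0 Km]]] := expR_sub_expR_le z0.
  have K2 : 2 * K * expR (- (m * n%:R)) @[n --> \oo] --> 0.
    rewrite -[X in _ --> X](mulr0 (2 * K)).
    by apply: cvgM; [exact: cvg_cst|exact: cvg_expRN_mul].
  have bnd w : `|f w| <= 2 * K * expR (- (m * `|w|)).
    rewrite (le_trans (fG w))// (le_trans (norm1_Gamma_kernel z w))//.
    by rewrite -mulrA ler_wpM2l.
  have sq (u : R^nat) : (forall n, `|u n| <= 2 * K * expR (- (m * n%:R))) ->
      u n @[n --> \oo] --> 0.
    move=> uK; apply/norm_cvg0P.
    apply: (@squeeze_cvgr _ _ _ _ (cst 0) (fun n => 2 * K * expR (- (m * n%:R)))).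
    - by apply: nearW => n; rewrite normr_ge0/= uK.
    - exact: cvg_cst.
    - exact: K2.
  by split; apply: sq => n; rewrite (le_trans (bnd _))// ?normrN ger0_norm.
have [iD1 iD2] := iD; have [cD1 cD2] := cD.
apply/eqP/complex_ext => /=.
  rewrite -[RHS](subrr (0 : R)).
  have [l1 l2] := G0 _ (fun w => normr_Re_le (Gamma_kernel z w)).
  apply: (@FTC_symT _ _ (fun w => complex.Re (Gamma_kernel z w)) _ _ iD1 cD1 _ l1 l2) => w.
  rewrite (_ : (fun w => _) = fun w =>
      expR (complex.Re z * w) * cos (complex.Im z * w) * expR (- expR w)); last first.
    by apply/funext => x; rewrite ReCZ Re_expC ReCZ ImCZ.
  rewrite /D /Gamma_kernel.
  apply: is_derive_eq; rewrite /GRing.scale/=.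
  rewrite !(Re_expC, Im_expC, ReCZ, ImCZ, ReCD, ImCD, ReCN, ReCM, ImCM) /=.
  rewrite addr0 mulrDl mul1r expRD; ring.
rewrite -[RHS](subrr (0 : R)).
have [l1 l2] := G0 _ (fun w => normr_Im_le (Gamma_kernel z w)).
apply: (@FTC_symT _ _ (fun w => complex.Im (Gamma_kernel z w)) _ _ iD2 cD2 _ l1 l2) => w.
rewrite (_ : (fun w => _) = fun w =>
    expR (complex.Re z * w) * sin (complex.Im z * w) * expR (- expR w)); last first.
  by apply/funext => x; rewrite ImCZ Im_expC ReCZ ImCZ.
rewrite /D /Gamma_kernel.
apply: is_derive_eq; rewrite /GRing.scale/=.
rewrite !(Re_expC, Im_expC, ReCZ, ImCZ, ReCD, ImCD, ImCN, ReCM, ImCM) /=.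
rewrite addr0 mulrDl mul1r expRD; ring.
Qed.

End gamma_function.

(** * The product Gamma(1-s) Gamma(s) as an integral over the line *)

Section reflection.
Context {R : realType}.
Implicit Types (z s : R[i]) (sigma lam t : R).
Local Notation mu := (@lebesgue_measure R).

(** With u = e^v this is the integral of e^(-c u) over ]0, +oo[. *)
Lemma integral_expR_exp (c : R) : 0 < c ->
  (\int[mu]_v (expR v * expR (- (c * expR v)))%:E = (c^-1)%:E)%E.
Proof.
move=> c0.
pose F (v : R) := - (expR (- (c * expR v)) / c).
have dF (v : R) : is_derive v 1 F (expR v * expR (- (c * expR v))).
  rewrite /F; apply: is_derive_eq; rewrite /GRing.scale/=; field.
  by rewrite lt0r_neq0.
have cf : continuous (fun v : R => expR v * expR (- (c * expR v))).
  move=> v; apply: cvgM; first exact: continuous_expR.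
  have cE : continuous (fun v : R => - (c * expR v)).
    by move=> u; apply: cvgN; apply: cvgM; [exact: cvg_cst|exact: continuous_expR].
  exact: (continuous_comp_fun cE (@continuous_expR R)).
rewrite (@ge0_FTC_sym _ _ F (- c^-1) 0)// ?sub0r ?opprK//.
- rewrite /F -oppr0 -[X in _ --> - X](mul0r c^-1).
  apply: cvgN; apply: cvgM; last exact: cvg_cst.
  apply: (@squeeze_cvgr _ _ _ _ (cst 0) (fun n => expR (- (c * n%:R)))).
  + apply: nearW => n; rewrite expR_ge0/= ler_expR lerN2 ler_pM2l//.
    by rewrite (le_trans _ (expR_ge1Dx _))// lerDr.
  + exact: cvg_cst.
  + exact: cvg_expRN_mul.
- suff : F (- n%:R) @[n --> \oo] --> - (expR 0 / c) by rewrite expR0 mul1r.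
  apply: cvgN; apply: cvgM; last exact: cvg_cst.
  have h : - (c * expR (- (1 * n%:R))) @[n --> \oo] --> (0 : R).
    by rewrite -oppr0 -(mulr0 c); apply: cvgN; apply: cvgM;
      [exact: cvg_cst|exact: cvg_expRN_mul].
  have := cvg_comp _ _ h (@continuous_expR R 0).
  by under eq_fun do rewrite mul1r.
Qed.

Lemma oneDexpR_gt0 (y : R) : 0 < 1 + expR y.
Proof. by rewrite addr_gt0 ?expR_gt0. Qed.

(** The denominator is at least e^y for y >= 0 and at least 1 for y < 0, which leaves the rates 1 -
    sigma and sigma. *)
Lemma logistic_le sigma : 0 < sigma < 1 -> exists2 m : R, 0 < m &
  forall y, expR (sigma * y) / (1 + expR y) <= expR (- (m * `|y|)).
Proof.
move=> /andP[s0 s1]; exists (Num.min sigma (1 - sigma)).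
  by rewrite lt_min s0 subr_gt0.
move=> y; rewrite ler_pdivrMr ?oneDexpR_gt0// mulrDr mulr1 -expRD.
have m1 : Num.min sigma (1 - sigma) <= sigma by rewrite ge_min lexx.
have m2 : Num.min sigma (1 - sigma) <= 1 - sigma by rewrite ge_min lexx orbT.
have [y0|y0] := leP 0 y.
  rewrite ler_wpDl ?expR_ge0// ler_expR ger0_norm//.
  by have := ler_wpM2r y0 m2; lra.
rewrite ler_wpDr ?expR_ge0// ler_expR ltr0_norm//.
by have := ler_wnM2r (ltW y0) m1; lra.
Qed.

Lemma continuous_logistic lam : continuous (fun y : R => (1 + expR (y - lam))^-1).
Proof.
have c1 : continuous (fun y : R => y - lam).
  by move=> y; apply: cvgB; [exact: cvg_id|exact: cvg_cst].
move=> y; apply: cvgV; first by rewrite lt0r_neq0 ?oneDexpR_gt0.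
apply: cvgD; first exact: cvg_cst.
exact: (continuous_comp_fun c1 (@continuous_expR R)).
Qed.

Lemma continuous_oneDexpRV : continuous (fun y : R => (1 + expR y)^-1).
Proof. by under eq_fun do rewrite -[X in expR X]subr0; exact: continuous_logistic. Qed.

Lemma integrable_logistic sigma : 0 < sigma < 1 ->
  mu.-integrable [set: R] (fun y => (expR (sigma * y) / (1 + expR y))%:E).
Proof.
move=> /logistic_le[m m0 hm].
apply: le_integrable (integrable_expN_abs m0) => //.
  apply/measurable_EFinP; apply: measurable_funM.
    by apply: measurableT_comp => //; exact: measurable_funM.
  by apply: continuous_measurable_fun; exact: continuous_oneDexpRV.
by move=> y _; rewrite lee_fin [leRHS]ger0_norm ?expR_ge0// ger0_norm//.
Qed.

(** The beta integral in logarithmic coordinates. In the product of the two Euler integrals over v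
    and y, shifting y by v gives the exponent s y + v; integrating over v first then leaves 1 / (1 +
    e^y). *)
Lemma Gamma_reflection_integral s : 0 < complex.Re s < 1 ->
  GammaC (1 - s) * GammaC s =
  integralC setT (fun y : R => expC (s * y%:C) * ((1 + expR y)^-1)%:C).
Proof.
move=> s01; have /andP[s0 s1] := s01.
have s0' : 0 < complex.Re (1 - s) by rewrite ReCD ReCN subr_gt0.
have i1 := integrableC_Gamma_kernel s0'; have i2 := integrableC_Gamma_kernel s0.
have mfst : measurable_fun [set: R * R] (fun p : R * R => p.1) by exact: measurable_fst.
have msnd : measurable_fun [set: R * R] (fun p : R * R => p.2) by exact: measurable_snd.
pose r (v y : R) := expR v * expR (- ((1 + expR y) * expR v)).
have mr : measurable_fun [set: R * R] (fun p => r p.1 p.2).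
  apply: measurable_funM; first exact: (measurableT_comp (@measurable_expR R) mfst).
  apply: measurableT_comp => //; apply: measurableT_comp => //.
  apply: measurable_funM; last exact: (measurableT_comp (@measurable_expR R) mfst).
  apply: measurable_funD; first exact: measurable_cst.
  exact: (measurableT_comp (@measurable_expR R) msnd).
pose f (p : R * R) := expC (s * p.2%:C) * (r p.1 p.2)%:C.
pose g (p : R * R) := 2 * expR (complex.Re s * p.2) * r p.1 p.2.
have r0 v y : 0 <= r v y by rewrite mulr_ge0 ?expR_ge0.
have ir y : (\int[mu]_v (r v y)%:E = ((1 + expR y)^-1)%:E)%E.
  by rewrite integral_expR_exp ?oneDexpR_gt0.
have mrv y : measurable_fun [set: R] (fun v => r v y).
  apply: measurable_funM => //; apply: measurableT_comp => //.
  by apply: measurableT_comp => //; apply: measurable_funM.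
have iry y : mu.-integrable [set: R] (fun v => (r v y)%:E).
  apply/integrableP; split; first by apply/measurable_EFinP; exact: mrv.
  by under eq_integral do rewrite gee0_abs ?lee_fin//; rewrite ir ltry.
rewrite [in LHS]GammaCE -integralCZr//.
transitivity (integralC setT (fun v => integralC setT (fun y => f (v, y)))).
  congr integralC; apply/funext => v; rewrite GammaCE -integralCZ//.
  rewrite (integralC_shift v); last first.
    apply: continuousCM; last exact: continuousC_Gamma_kernel.
    by split=> x; exact: cvg_cst.
  congr integralC; apply/funext => y; rewrite /f /r /Gamma_kernel /=.
  rewrite mulrACA -expCD -rmorphM.
  rewrite (_ : (1 - s) * v%:C + s * (y + v)%:C = s * y%:C + v%:C); last first.
    by rewrite rmorphD; ring.
  rewrite expCD expC_real -mulrA -rmorphM.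
  by congr (_ * (_)%:C); rewrite -!expRD; congr expR; rewrite expRD; ring.
rewrite (@integralC_Fubini _ f g).
- congr integralC; apply/funext => y; rewrite /f/= integralCZ.
    by rewrite integralC_real /Rintegral ir.
  split => //=; exact: integrable0.
- apply: measurableCM; last exact: measurableC_real.
  apply: measurableC_expC; apply: measurableCM; first exact: measurableC_cst.
  exact: measurableC_real.
(* Integrability of the majorant is tested with v innermost, where the integral is explicit. *)
- apply/integrable21ltyP.
    apply/measurable_EFinP; apply: measurable_funM => //.
    apply: measurable_funM => //; apply: measurableT_comp => //.
    exact: measurable_funM.
  rewrite (_ : (\int[mu]_y _)%E =
    (\int[mu]_y (2%:E * (expR (complex.Re s * y) / (1 + expR y))%:E))%E).
    exact: integrable_lty (integrableZl measurableT 2 (integrable_logistic s01)).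
  apply: eq_integral => y _; rewrite /g/=.
  under eq_integral do rewrite ger0_norm ?mulr_ge0 ?expR_ge0// EFinM.
  rewrite ge0_integralZl//.
  + by rewrite ir -!EFinM mulrA.
  + by apply/measurable_EFinP; exact: mrv.
  + by move=> v _; rewrite lee_fin.
- move=> p; rewrite (le_trans (norm1M _ _))// norm1_real ger0_norm//.
  by rewrite ler_wpM2r// (le_trans (norm1_expC _))// ReCZ.
Qed.

End reflection.

(** * Mellin inversion *)

Section mellin_inversion.
Context {R : realType}.
Implicit Types (z s : R[i]) (sigma lam t : R).
Local Notation mu := (@lebesgue_measure R).

(** The constant 2 comes from (sigma + |t|)^2 <= 2 (sigma^2 + t^2). *)
Lemma norm1_invC sigma t : 0 < sigma ->
  norm1 (sigma +i* t)^-1 <= 2 / (sigma + `|t|).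
Proof.
move=> s0.
have n0 : 0 < sigma ^+ 2 + t ^+ 2 by rewrite ltr_pwDl ?exprn_gt0 ?sqr_ge0.
have st0 : 0 < sigma + `|t| by rewrite ltr_pwDl.
have -> : (sigma +i* t)^-1 = (sigma / (sigma ^+ 2 + t ^+ 2)) +i*
    - (t / (sigma ^+ 2 + t ^+ 2)).
  apply: mulr1_eq; apply: complex_ext; rewrite ?ReCM ?ImCM/=; field;
  by rewrite lt0r_neq0.
rewrite /norm1/= normrN !normrM !normfV (ger0_norm (ltW s0)) (ger0_norm (ltW n0)) -mulrDl.
rewrite ler_pdivrMr// mulrAC ler_pdivlMr//.
have := sqr_ge0 (sigma - `|t|); rewrite -(real_normK (num_real t)); nra.
Qed.

(** The bound depends on Re z alone, hence is uniform along a vertical line. *)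
Lemma norm1_GammaC_le z : 0 < complex.Re z -> norm1 (GammaC z) <=
  2 * \int[mu]_w (2 * expR (complex.Re z * w - expR w)).
Proof.
move=> z0; rewrite GammaCE; apply: norm1_integralC_le.
- exact: integrableC_Gamma_kernel.
- under eq_fun do rewrite EFinM.
  by apply: integrableZl => //; exact: integrable_expR_sub_expR.
- exact: norm1_Gamma_kernel.
Qed.

(* Lowering both arguments by the functional equation produces the factor
   [1 / (s * (1 - s))], which is integrable along the vertical line. *)
Lemma Gamma_reflection_decay sigma : 0 < sigma < 1 -> exists2 K : R, 0 <= K &
  forall t, norm1 (GammaC (1 - (sigma +i* t)) * GammaC (sigma +i* t)) <=
    K * (1 + t ^+ 2)^-1.
Proof.
move=> /andP[s0 s1].
pose B (x : R) := 2 * \int[mu]_w (2 * expR (x * w - expR w)).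
have B0 x : 0 <= B x.
  by rewrite mulr_ge0// Rintegral_ge0// => w _; rewrite mulr_ge0 ?expR_ge0.
have bound (a t : R) : 0 < a ->
    norm1 (GammaC (a +i* t)) <= 2 / (a + `|t|) * B (a + 1).
  move=> a0; have nz : a +i* t != 0.
    by rewrite eq_complex/= negb_and lt0r_neq0.
  have -> : GammaC (a +i* t) = (a +i* t)^-1 * GammaC (a +i* t + 1).
    by rewrite GammaCD1// mulKf.
  rewrite (le_trans (norm1M _ _))// ler_pM ?norm1_ge0 ?norm1_invC//.
  by rewrite (le_trans (norm1_GammaC_le _)) ?ReCD//= addr_gt0.
(* Chosen because (1 - sigma + |t|) (sigma + |t|) = m + |t| + t^2 >= m (1 + t^2), as m <= 1. *)
pose m := sigma * (1 - sigma).
have s1' : 0 < 1 - sigma by rewrite subr_gt0.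
have m0 : 0 < m by rewrite mulr_gt0.
have C0 : 0 <= 4 * B (1 - sigma + 1) * B (sigma + 1).
  by apply: mulr_ge0 => //; exact: mulr_ge0.
exists (4 * B (1 - sigma + 1) * B (sigma + 1) / m).
  by apply: divr_ge0 => //; exact: ltW.
move=> t.
have -> : 1 - (sigma +i* t) = (1 - sigma) +i* (- t).
  by apply: complex_ext; rewrite ?ReCD ?ReCN ?ImCD ?ImCN/= ?sub0r.
have b1 := bound _ (- t) s1'; have b2 := bound _ t s0.
rewrite (le_trans (norm1M _ _))// (le_trans (ler_pM _ _ b1 b2)) ?norm1_ge0//.
rewrite normrN.
have t1 : 0 < 1 - sigma + `|t| by rewrite ltr_pwDl.
have t2 : 0 < sigma + `|t| by rewrite ltr_pwDl.
have t3 : 0 < 1 + t ^+ 2 by rewrite ltr_pwDl ?sqr_ge0.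
rewrite [leLHS](_ : _ = 4 * B (1 - sigma + 1) * B (sigma + 1) *
  ((1 - sigma + `|t|) * (sigma + `|t|))^-1); last first.
  by field; rewrite !lt0r_neq0.
rewrite -[leRHS]mulrA -invfM; apply: (ler_wpM2l C0).
rewrite lef_pV2 ?posrE ?mulr_gt0//.
rewrite -(real_normK (num_real t)) /m; have := normr_ge0 t; nra.
Qed.

(** Fubini gives measurability of the partial integral for functions integrable on the plane,
    whereas the bound [g] does not decay in t. The weight e^(-|t|) restores integrability and is
    divided out afterwards. *)
Lemma measurable_Rintegral_param (f : R * R -> R) (g : R -> R) :
  measurable_fun [set: R * R] f ->
  mu.-integrable [set: R] (fun y => (g y)%:E) ->
  (forall t y, `|f (t, y)| <= g y) ->
  measurable_fun [set: R] (fun t => \int[mu]_y f (t, y)).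
Proof.
move=> mf ig fg.
pose k t := expR (- (1 * `|t|)).
have mk : measurable_fun [set: R] k by exact: measurable_expN_abs.
have ikf : (mu \x mu)%E.-integrable [set: R * R] (fun p => (k p.1 * f p)%:E).
  apply: le_integrable (integrable_prod (integrable_expN_abs ltr01) ig) => //.
    apply/measurable_EFinP; apply: measurable_funM => //.
    by apply: (measurableT_comp mk); exact: measurable_fst.
  move=> [t y] _; rewrite lee_fin !normrM ler_wpM2l//.
  by rewrite (le_trans (fg t y)) ?ler_norm.
have ift t : mu.-integrable [set: R] (fun y => (f (t, y))%:E).
  apply: le_integrable ig => //.
    by apply/measurable_EFinP; exact: (measurableT_comp mf (pair1_measurable t)).
  by move=> y _; rewrite lee_fin (le_trans (fg t y)) ?ler_norm.
rewrite (_ : (fun t => _) = fun t =>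
    expR `|t| * \int[mu]_y (k t * f (t, y))); last first.
  apply/funext => t; rewrite (RintegralZl _ measurableT (ift t)) mulrA -expRD.
  by rewrite mul1r subrr expR0 mul1r.
apply: measurable_funM.
  by apply: (measurableT_comp (@measurable_expR R)); exact: normr_measurable.
exact: (measurableT_comp (@fine_measurable R setT measurableT)
  (measurable_fubini_F ikf)).
Qed.

Lemma measurableC_integralC (f : R * R -> R[i]) (g : R -> R) :
  measurableC f -> mu.-integrable [set: R] (fun y => (g y)%:E) ->
  (forall t y, norm1 (f (t, y)) <= g y) ->
  measurableC (fun t => integralC setT (fun y => f (t, y))).
Proof.
move=> [mf1 mf2] ig fg; split => /=.
  apply: (measurable_Rintegral_param (f := fun p => complex.Re (f p)) _ ig) => // t y.
  exact: le_trans (normr_Re_le _) (fg t y).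
apply: (measurable_Rintegral_param (f := fun p => complex.Im (f p)) _ ig) => // t y.
exact: le_trans (normr_Im_le _) (fg t y).
Qed.

(** Measurability in t is read off the reflection integral, whose integrand has a bound independent
    of t. *)
Lemma measurableC_Gamma_reflection sigma : 0 < sigma < 1 ->
  measurableC (fun t => GammaC (1 - (sigma +i* t)) * GammaC (sigma +i* t)).
Proof.
move=> s01; under eq_fun do rewrite Gamma_reflection_integral//.
apply: (@measurableC_integralC
  (fun p => expC ((sigma +i* p.1) * p.2%:C) * ((1 + expR p.2)^-1)%:C)
  (fun y => 2 * (expR (sigma * y) / (1 + expR y)))).
- have m2 : measurable_fun [set: R * R] (fun p : R * R => p.2) by exact: measurable_snd.
  apply: measurableCM.
    apply: measurableC_expC; apply: measurableCM; last exact: measurableC_real.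
    exact: (measurableC_comp (measurableC_line sigma) measurable_fst).
  apply: measurableC_real; apply: (measurableT_comp _ m2 (f := fun y => (1 + expR y)^-1)).
  by apply: continuous_measurable_fun; exact: continuous_oneDexpRV.
- under eq_fun do rewrite EFinM.
  by apply: integrableZl => //; exact: integrable_logistic.
- move=> t y; rewrite (le_trans (norm1M _ _))// norm1_real mulrA ger0_norm.
    by rewrite ler_wpM2r ?invr_ge0 ?(ltW (oneDexpR_gt0 _))// (le_trans (norm1_expC _))// ReCZ.
  by rewrite invr_ge0 ltW// oneDexpR_gt0.
Qed.

(** The shift y -> y - lam cancels the exponential factor, so that [lam] only translates the
    logistic function. *)
Lemma Gamma_reflection_expC sigma lam t : 0 < sigma < 1 ->
  GammaC (1 - (sigma +i* t)) * GammaC (sigma +i* t) *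
    expC ((sigma +i* t) * lam%:C) =
  (\int[mu]_y (expR (sigma * y) / (1 + expR (y - lam)) * cos (t * y))) +i*
  (\int[mu]_y (expR (sigma * y) / (1 + expR (y - lam)) * sin (t * y))).
Proof.
move=> s01; rewrite Gamma_reflection_integral// -integralCZr; last first.
  apply: (@le_integrableC _ _ (fun y => 2 * (expR (sigma * y) / (1 + expR y)))).
  - apply: continuousC_measurable; apply: continuousCM.
      exact: continuousC_expC.
    by apply: continuousC_real; exact: continuous_oneDexpRV.
  - under eq_fun do rewrite EFinM.
    by apply: integrableZl => //; exact: integrable_logistic.
  - move=> y; rewrite (le_trans (norm1M _ _))// norm1_real mulrA ger0_norm.
      by rewrite ler_wpM2r ?invr_ge0 ?(ltW (oneDexpR_gt0 _))// (le_trans (norm1_expC _))// ReCZ.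
    by rewrite invr_ge0 ltW// oneDexpR_gt0.
rewrite (integralC_shift (- lam)); last first.
  apply: continuousCM; last by split => x; exact: cvg_cst.
  apply: continuousCM; first exact: continuousC_expC.
  by apply: continuousC_real; exact: continuous_oneDexpRV.
have E y : expC ((sigma +i* t) * (y - lam)%:C) * ((1 + expR (y - lam))^-1)%:C *
    expC ((sigma +i* t) * lam%:C) =
    expC ((sigma +i* t) * y%:C) * ((1 + expR (y - lam))^-1)%:C.
  rewrite mulrAC -expCD; congr (expC _ * _).
  by rewrite -mulrDr -rmorphD subrK.
rewrite /integralC; congr (_ +i* _); apply: eq_Rintegral => y _; rewrite E.
  by rewrite ReCZ Re_expC ReCZ ImCZ/=; ring.
by rewrite ImCZ Im_expC ReCZ ImCZ/=; ring.
Qed.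

(** The one-variable Mellin-Barnes integrand at X = e^lam, on the line Re s = sigma. *)
Definition mellin_integrand sigma lam t : R[i] :=
  GammaC (1 - (sigma +i* t)) * GammaC (sigma +i* t) *
  expC ((sigma +i* t) * lam%:C).

Lemma measurableC_mellin_integrand sigma lam : 0 < sigma < 1 ->
  measurableC (mellin_integrand sigma lam).
Proof.
move=> s01; apply: measurableCM; first exact: measurableC_Gamma_reflection.
apply: measurableC_expC; apply: measurableCM; first exact: measurableC_line.
exact: measurableC_cst.
Qed.

Lemma norm1_mellin_integrand_le sigma lam : 0 < sigma < 1 ->
  exists2 K : R, 0 <= K &
    forall t, norm1 (mellin_integrand sigma lam t) <= K * (1 + t ^+ 2)^-1.
Proof.
move=> s01; have [K K0 decay] := Gamma_reflection_decay s01.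
exists (2 * expR (sigma * lam) * K).
  by apply: mulr_ge0 => //; rewrite mulr_ge0 ?expR_ge0.
move=> t; rewrite (le_trans (norm1M _ _))// mulrC -mulrA ler_pM ?norm1_ge0//.
by rewrite (le_trans (norm1_expC _))// ReCZ.
Qed.

Lemma integrableC_mellin_integrand sigma lam : 0 < sigma < 1 ->
  integrableC (mellin_integrand sigma lam).
Proof.
move=> s01; have [K K0 hK] := norm1_mellin_integrand_le lam s01.
apply: (@le_integrableC _ _ (fun t => K * (1 + t ^+ 2)^-1)) => //.
  exact: measurableC_mellin_integrand.
under eq_fun do rewrite EFinM.
by apply: integrableZl => //; exact: integrable_cauchy.
Qed.

(** The integrand is a Fourier transform: its real part falls under cosine inversion at 0, and its
    imaginary part, a sine transform, is odd in t. The decay of Gamma(1-s) Gamma(s) supplies the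
    integrability of the transform. *)
Lemma mellin_inversion sigma lam : 0 < sigma < 1 ->
  integralC setT (mellin_integrand sigma lam) = (2 * pi / (1 + expR (- lam)))%:C.
Proof.
move=> s01.
pose h (y : R) := expR (sigma * y) / (1 + expR (y - lam)).
have ch : continuous h.
  move=> y; apply: cvgM; last exact: continuous_logistic.
  have cM : continuous (fun y : R => sigma * y).
    by move=> x; apply: cvgM; [exact: cvg_cst|exact: cvg_id].
  exact: (continuous_comp_fun cM (@continuous_expR R)).
have [m m0 hm] := logistic_le s01.
have h_shift y : h y = expR (sigma * lam) * (expR (sigma * (y - lam)) / (1 + expR (y - lam))).
  by rewrite mulrA -expRD /h; congr (expR _ / _); ring.
have h0 y : 0 <= h y by rewrite divr_ge0 ?expR_ge0// ltW// oneDexpR_gt0.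
have hM y : 0 <= h y <= expR (sigma * lam).
  rewrite h0/= h_shift ler_piMr ?expR_ge0// (le_trans (hm _))//.
  by rewrite -expR0 ler_expR oppr_le0 mulr_ge0// ltW.
have ih : mu.-integrable [set: R] (fun y => (h y)%:E).
  (* The second factor of the constant comes from |y| <= |y - lam| + |lam|. *)
  apply: le_integrable (integrableZl measurableT (expR (sigma * lam) * expR (m * `|lam|))
    (integrable_expN_abs m0)) => //.
    by apply/measurable_EFinP; exact: continuous_measurable_fun.
  move=> y _; rewrite -EFinM lee_fin (ger0_norm (h0 y)) (le_trans _ (ler_norm _))//.
  rewrite h_shift -mulrA ler_wpM2l ?expR_ge0// (le_trans (hm _))//.
  rewrite -expRD ler_expR.
  have := ler_normD (y - lam) lam; rewrite subrK => yl.
  by have := ler_wpM2l (ltW m0) yl; lra.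
pose G := mellin_integrand sigma lam.
have GE t : G t = (\int[mu]_y (h y * cos (t * y))) +i* (\int[mu]_y (h y * sin (t * y))).
  exact: Gamma_reflection_expC.
have mG : measurableC G by exact: measurableC_mellin_integrand.
have iG : integrableC G by exact: integrableC_mellin_integrand.
have [iG1 _] := iG; have [_ mG2] := mG.
rewrite -/G; clearbody G; apply: complex_ext => /=.
  under eq_Rintegral do rewrite GE/=.
  rewrite (cosine_inversion ch hM ih).
    by rewrite /h mulr0 expR0 sub0r mul1r.
  by move: iG1; under eq_fun do rewrite GE/=.
apply: Rintegral_odd => // t; rewrite !GE/=.
transitivity (\int[mu]_y (-1 * (h y * sin (t * y)))).
  by apply: eq_Rintegral => y _; rewrite [- t * y]mulNr sinN; ring.
rewrite RintegralZl ?mulN1r//.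
apply: le_integrable ih => //.
  apply/measurable_EFinP; apply: measurable_funM.
    exact: continuous_measurable_fun.
  apply: measurableT_comp; first by apply: continuous_measurable_fun; exact: continuous_sin.
  by apply: measurable_funM.
by move=> y _; rewrite lee_fin normrM ler_piMr// sin_max.
Qed.

End mellin_inversion.

(** * The iterated Mellin-Barnes integral *)

Section mellin_barnes.
Context {R : realType}.
Local Notation mu := (@lebesgue_measure R).

(** For lam l = ln x_l this is the product of the F_l at e^w / zeta, in the variable w = ln u. *)
Definition logistic_prod n (beta lam : 'I_n -> R) (w : R) : R :=
  \prod_(l < n) (1 + expR (- (lam l + beta l * w)))^-1.

Lemma logistic_prod_itv n (beta lam : 'I_n -> R) w :
  0 <= logistic_prod beta lam w <= 1.
Proof.
have h l : 0 <= (1 + expR (- (lam l + beta l * w)))^-1 <= 1.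
  by rewrite invr_ge0 ltW ?oneDexpR_gt0//= invf_le1 ?oneDexpR_gt0// lerDl expR_ge0.
apply/andP; split; first by apply: prodr_ge0 => l _; have /andP[] := h l.
by apply: prodr_ile1 => l _.
Qed.

Lemma measurable_logistic_prod n (beta lam : 'I_n -> R) :
  measurable_fun [set: R] (logistic_prod beta lam).
Proof.
apply: measurable_prod => l _.
apply: (@measurableT_comp _ _ _ _ _ _ (fun y : R => (1 + expR y)^-1)).
  by apply: continuous_measurable_fun; exact: continuous_oneDexpRV.
apply: measurableT_comp => //; apply: measurable_funD; first exact: measurable_cst.
exact: measurable_funM.
Qed.

Lemma integrableC_Gamma_kernelM (z : R[i]) (Q : R -> R) : 0 < complex.Re z ->
  measurable_fun [set: R] Q -> (forall w, 0 <= Q w <= 1) ->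
  integrableC (fun w => Gamma_kernel z w * (Q w)%:C).
Proof.
move=> z0 mQ Q01.
apply: (@le_integrableC _ _ (fun w => 2 * expR (complex.Re z * w - expR w))).
- apply: measurableCM; last exact: measurableC_real.
  by apply: continuousC_measurable; exact: continuousC_Gamma_kernel.
- under eq_fun do rewrite EFinM.
  by apply: integrableZl => //; exact: integrable_expR_sub_expR.
- move=> w; have /andP[Q0 Q1] := Q01 w.
  rewrite (le_trans (norm1M _ _))// norm1_real ger0_norm//.
  by rewrite (le_trans _ (norm1_Gamma_kernel z w))// ler_piMr// norm1_ge0.
Qed.

(** Both [z] and [c] are free for the induction: the outermost variable moves z to z + beta_0 s_0,
    and its own factors join the scalar c. After the exchange of integrals, inversion in s_0
    restores the factor of index 0 in [logistic_prod]. *)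
Lemma vlines_integralE n (beta sigma lam : 'I_n -> R) (z c : R[i]) :
  (forall l, 0 < beta l) -> (forall l, 0 < sigma l < 1) -> 0 < complex.Re z ->
  vlines_integral sigma (fun s =>
    c * (GammaC (z + \sum_(l < n) (beta l)%:C * s l) *
      \prod_(l < n) (GammaC (1 - s l) * GammaC (s l) * expC (s l * (lam l)%:C)))) =
  ((2 * pi)%:C * 'i%C) ^+ n *
    (c * integralC setT (fun w => Gamma_kernel z w * (logistic_prod beta lam w)%:C)).
Proof.
elim: n beta sigma lam z c => [|n IHn] beta sigma lam z c hbeta hsigma z0.
  rewrite /= !big_ord0 addr0 mulr1 expr0 mul1r GammaCE; congr (_ * integralC _ _).
  by apply/funext => w; rewrite /logistic_prod big_ord0 mulr1.
pose A : R[i] := (2 * pi)%:C * 'i%C.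
pose b0 := beta ord0; pose s0 := sigma ord0; pose l0 := lam ord0.
pose beta' := fun i => beta (lift ord0 i); pose lam' := fun i => lam (lift ord0 i).
pose Q' := logistic_prod beta' lam'.
have Q'01 w : 0 <= Q' w <= 1 by exact: logistic_prod_itv.
have mQ' : measurable_fun [set: R] Q' by exact: measurable_logistic_prod.
have b0_gt0 : 0 < b0 by exact: hbeta.
have s0_01 : 0 < s0 < 1 by exact: hsigma.
have /andP[s0_gt0 _] := s0_01.
pose k := A ^+ n * c.
pose zt (t : R) := z + b0%:C * (s0 +i* t).
have Re_zt t : complex.Re (zt t) = complex.Re z + b0 * s0.
  by rewrite /zt ReCD mulrC ReCZ mulrC.
have zt0 t : 0 < complex.Re (zt t) by rewrite Re_zt addr_gt0// mulr_gt0.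
pose f (p : R * R) := k * (mellin_integrand s0 l0 p.1 *
  (Gamma_kernel (zt p.1) p.2 * (Q' p.2)%:C)).
have fE t : A ^+ n * ((c * mellin_integrand s0 l0 t) *
    integralC setT (fun w => Gamma_kernel (zt t) w * (Q' w)%:C)) =
    integralC setT (fun w => f (t, w)).
  rewrite /f /=; have i1 := integrableC_Gamma_kernelM (zt0 t) mQ' Q'01.
  by rewrite !integralCZ//; [rewrite /k; ring|exact: integrableCZ].
have [K K0 hK] := norm1_mellin_integrand_le l0 s0_01.
have -> : vlines_integral sigma (fun s =>
    c * (GammaC (z + \sum_(l < n.+1) (beta l)%:C * s l) *
      \prod_(l < n.+1) (GammaC (1 - s l) * GammaC (s l) * expC (s l * (lam l)%:C)))) =
    'i%C * integralC setT (fun t => integralC setT (fun w => f (t, w))).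
  rewrite /= /vline_integral; congr (_ * integralC _ _); apply/funext => t.
  rewrite -fE -(IHn beta' (fun i => sigma (lift ord0 i)) lam' (zt t)
    (c * mellin_integrand s0 l0 t) (fun l => hbeta _) (fun l => hsigma _) (zt0 t)).
  congr (vlines_integral _ _); apply/funext => s.
  rewrite !big_ord_recl /fcons unlift_none /=.
  under eq_bigr do rewrite liftK /=.
  under [X in _ * (_ * (_ * X)) = _]eq_bigr do rewrite !liftK /=.
  by rewrite /zt /mellin_integrand /lam' /beta' /b0 /s0 /l0 addrA; ring.
(* The real part of [zt t] does not depend on t, so the majorant splits into a function of t times a
   function of w. *)
rewrite (@integralC_Fubini _ f (fun p =>
    (norm1 k * K * (1 + p.1 ^+ 2)^-1) *
    (2 * expR ((complex.Re z + b0 * s0) * p.2 - expR p.2)))).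
- have -> : (fun w => integralC setT (fun t => f (t, w))) = fun w =>
      (k * (2 * pi)%:C) * (Gamma_kernel z w * (logistic_prod beta lam w)%:C).
    apply/funext => w.
    (* The factor e^(beta_0 s_0 w) contained in the kernel at [zt t] is absorbed by replacing [l0]
       with l0 + b0 w. *)
    have -> : (fun t => f (t, w)) = fun t => (k * (Gamma_kernel z w * (Q' w)%:C)) *
        mellin_integrand s0 (l0 + b0 * w) t.
      apply/funext => t; rewrite /f/= /mellin_integrand /Gamma_kernel /zt.
      rewrite mulrDl expCD rmorphD mulrDr expCD rmorphM.
      rewrite (_ : b0%:C * (s0 +i* t) * w%:C = (s0 +i* t) * (b0%:C * w%:C)); last by ring.
      ring.
    rewrite integralCZ; last exact: integrableC_mellin_integrand.
    rewrite mellin_inversion// /logistic_prod big_ord_recl -/(logistic_prod _ _ _).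
    by rewrite !rmorphM /=; ring.
  rewrite integralCZ; last first.
    apply: integrableC_Gamma_kernelM => //; first exact: measurable_logistic_prod.
    by move=> w; exact: logistic_prod_itv.
  by rewrite /k exprS -/A {2}/A; ring.
- have m1 : measurable_fun [set: R * R] (fun p : R * R => p.1) by exact: measurable_fst.
  have m2 : measurable_fun [set: R * R] (fun p : R * R => p.2) by exact: measurable_snd.
  apply: measurableCM; first exact: measurableC_cst.
  apply: measurableCM.
    exact: (measurableC_comp (measurableC_mellin_integrand l0 s0_01) m1).
  apply: measurableCM; last first.
    by apply: measurableC_real; exact: (measurableT_comp mQ' m2).
  apply: measurableCM; last first.
    apply: measurableC_real; apply: measurableT_comp => //.
    apply: measurableT_comp => //.
    exact: (measurableT_comp (@measurable_expR R) m2).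
  apply: measurableC_expC; apply: measurableCM; last exact: measurableC_real.
  apply: measurableCD; first exact: measurableC_cst.
  apply: measurableCM; first exact: measurableC_cst.
  exact: (measurableC_comp (measurableC_line s0) m1).
- apply: (@integrable_prod _ (fun t => norm1 k * K * (1 + t ^+ 2)^-1)
    (fun w => 2 * expR ((complex.Re z + b0 * s0) * w - expR w))).
    under eq_fun do rewrite EFinM.
    by apply: integrableZl => //; exact: integrable_cauchy.
  under eq_fun do rewrite EFinM.
  apply: integrableZl => //; apply: integrable_expR_sub_expR.
  by rewrite addr_gt0// mulr_gt0.
- move=> [t w]; rewrite (le_trans (norm1M _ _))//.
  rewrite [leRHS](_ : _ = norm1 k * ((K * (1 + t ^+ 2)^-1) *
    (2 * expR ((complex.Re z + b0 * s0) * w - expR w)))); last by rewrite !mulrA.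
  rewrite ler_wpM2l ?norm1_ge0// (le_trans (norm1M _ _))// ler_pM ?norm1_ge0//.
  have /andP[Q0 Q1] := Q'01 w.
  rewrite (le_trans (norm1M _ _))// norm1_real ger0_norm//.
  by rewrite -(Re_zt t) (le_trans _ (norm1_Gamma_kernel (zt t) w))// ler_piMr// norm1_ge0.
Qed.

End mellin_barnes.

(** * The average error rate *)

Section error_rate.
Context {R : realType}.
Local Notation mu := (@lebesgue_measure R).

(** Tonelli's theorem works in the extended reals; finiteness of the Gaussian tail gives the
    passage. *)
Lemma erfcE (x : R) : ((erfc x)%:E =
  (2 / Num.sqrt pi)%:E * \int[mu]_(t in `[x, +oo[) (expR (- t ^+ 2))%:E)%E.
Proof.
rewrite /erfc EFinM; congr (_ * _)%E; rewrite /Rintegral fineK//.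
apply: integrable_fin_num => //.
by apply: integrableS integrableT_gauss.
Qed.

(* Tonelli on [erfc (sqrt (zeta g)) f g] amounts to integrating by parts, and
   replaces the density by the distribution function. *)
Lemma avg_ber_cdf (delta zeta : R) (f C : R -> R) : 0 < delta -> 0 < zeta ->
  measurable_fun [set: R] f -> (forall x, 0 <= f x) ->
  continuous C -> (forall w, 0 <= C w <= 1) ->
  (forall m, 0 < m ->
    (\int[mu]_(x in `[0%R, m]) (f x)%:E = (C (ln (zeta * m)))%:E)%E) ->
  avg_ber delta zeta f =
  delta / Num.sqrt pi * \int[mu]_w (expR (2^-1 * w - expR w) * C w).
Proof.
move=> d0 z0 mf f0 cC C01 fC.
have sqrt_le (g t : R) : 0 <= g -> 0 <= t ->
    (Num.sqrt (zeta * g) <= t) = (zeta * g <= t ^+ 2).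
  move=> g0 t0; rewrite -(ler_sqrt (zeta * g) (sqr_ge0 t)).
  by rewrite sqrtr_sqr ger0_norm.
have zeta_le (g t : R) : (zeta * g <= t ^+ 2) = (g <= t ^+ 2 / zeta).
  by rewrite ler_pdivlMr// mulrC.
have t2z (t : R) : 0 < t -> 0 < t ^+ 2 / zeta.
  by move=> t0; rewrite divr_gt0// exprn_gt0.
have zK (t : R) : zeta * (t ^+ 2 / zeta) = t ^+ 2.
  by rewrite mulrCA divff ?mulr1// lt0r_neq0.
have C0 w : 0 <= C w by have /andP[] := C01 w.
have mC := continuous_measurable_fun cC.
pose c : R := delta * (2 / Num.sqrt pi).
have sqrtpi_gt0 : 0 < Num.sqrt (pi : R) by rewrite sqrtr_gt0 pi_gt0.
have c0 : 0 <= c by rewrite mulr_ge0 ?divr_ge0 ?ltW.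
have cE : c = delta * (2 / Num.sqrt pi) by [].
clearbody c.
have half0 : 0 < 2^-1 :> R by rewrite invr_gt0.
have iC : mu.-integrable [set: R] (EFin \o (fun w => expR (2^-1 * w - expR w) * C w)).
  apply: le_integrable (integrable_expR_sub_expR half0) => //.
    apply/measurable_EFinP; apply: measurable_funM => //.
    exact: measurable_expR_sub_expR.
  move=> w _; rewrite lee_fin normrM ler_piMr// ger0_norm//.
  by have /andP[] := C01 w.
(* What remains at height t once the density has been integrated: C (ln (t^2)) is its integral over
   [0, t^2 / zeta]. *)
pose k (t : R) := c * (expR (- t ^+ 2) * C (ln (t ^+ 2))).
have k0 t : 0 <= k t by rewrite mulr_ge0// mulr_ge0 ?expR_ge0.
have ck : {in `]0, +oo[, continuous k}.
  move=> t; rewrite in_itv/= andbT => t0; apply: cvgM; first exact: cvg_cst.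
  apply: cvgM; first exact: continuous_gauss_fun.
  have cln : ln (x ^+ 2) @[x --> t] --> ln (t ^+ 2).
    exact: (cvg_comp _ _ (@exprn_continuous _ 2 t) (continuous_ln (exprn_gt0 2 t0))).
  exact: (cvg_comp _ _ cln (cC _)).
(* Substitution t = e^(w/2), that is u = t^2 = e^w; the 1/2 of the Jacobian cancels the 2 in
   [erfc]. *)
have kE w : k (expR (2^-1 * w)) * (2^-1 * expR (2^-1 * w)) =
    delta / Num.sqrt pi * (expR (2^-1 * w - expR w) * C w).
  rewrite /k -expRM_natl (_ : 2%:R * (2^-1 * w) = w); last by field.
  rewrite expRK [expR (2^-1 * w - _)]expRD cE; field.
  by rewrite lt0r_neq0.
pose h (p : R * R) := c * (f p.1 * expR (- p.2 ^+ 2)).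
have h0 p : 0 <= h p by rewrite !mulr_ge0 ?expR_ge0.
(* The condition sqrt(zeta g) <= t is written with squares, hence the separate test 0 <= t. *)
pose Phi (p : R * R) : R :=
  if (0 <= p.1) && ((0 <= p.2) && (zeta * p.1 <= p.2 ^+ 2)) then h p else 0.
have m1 : measurable_fun [set: R * R] (fun p : R * R => p.1) by exact: measurable_fst.
have m2 : measurable_fun [set: R * R] (fun p : R * R => p.2) by exact: measurable_snd.
have m0 : measurable_fun [set: R * R] (fun p : R * R => 0 : R) by exact: measurable_cst.
have m22 : measurable_fun [set: R * R] (fun p : R * R => p.2 ^+ 2) by exact: measurable_funX.
have mexpN2 : measurable_fun [set: R] (fun t : R => expR (- t ^+ 2)).
  exact: measurable_gauss_fun.
have mh : measurable_fun [set: R * R] h.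
  apply: measurable_funM => //; apply: measurable_funM.
    exact: (measurableT_comp mf m1).
  exact: (measurableT_comp mexpN2 m2).
have mPhi : measurable_fun [set: R * R] Phi.
  rewrite (_ : Phi = fun p => if 0 <= p.1 then
      if 0 <= p.2 then if zeta * p.1 <= p.2 ^+ 2 then h p else 0 else 0 else 0).
    apply: measurable_fun_ifT => //; first exact: measurable_fun_ler.
    apply: measurable_fun_ifT => //; first exact: measurable_fun_ler.
    by apply: measurable_fun_ifT => //; apply: measurable_fun_ler => //; exact: measurable_funM.
  by apply/funext => p; rewrite /Phi; case: (0 <= p.1) => //; case: (0 <= p.2).
have Phi0 p : 0 <= Phi p by rewrite /Phi; case: ifP => _; [exact: h0|exact: lexx].
have Fub := @fubini_tonelli _ _ _ _ _ mu mu (EFin \o Phi).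
have inner_t (g : R) : (\int[mu]_t (Phi (g, t))%:E = if (0 <= g)%R then
    (delta * erfc (Num.sqrt (zeta * g)) * f g)%:E else 0)%E.
  case: ifPn => g0; last first.
    by apply: integral0_eq => t _; rewrite /Phi/= (negbTE g0).
  have -> : ((delta * erfc (Num.sqrt (zeta * g)) * f g)%:E = (c * f g)%:E *
      \int[mu]_(t in `[Num.sqrt (zeta * g), +oo[) (expR (- t ^+ 2))%:E)%E.
    rewrite [c * f g](_ : _ = delta * f g * (2 / Num.sqrt pi)); last first.
      by rewrite cE mulrAC.
    by rewrite [in RHS]EFinM -muleA -erfcE -EFinM mulrAC.
  have cf0 : 0 <= c * f g by rewrite mulr_ge0.
  rewrite -[RHS]ge0_integralZl_EFin; [|by []|by move=> t _; rewrite lee_fin expR_ge0|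
    by apply/measurable_EFinP; exact: measurable_funTS|by []].
  rewrite [RHS]integral_mkcond; apply: eq_integral => t _; rewrite patchE.
  rewrite /Phi/= g0/= mem_setE in_itv/= andbT.
  have [t0|t0] := leP 0 t; last by rewrite [Num.sqrt _ <= _]leNgt (lt_le_trans t0 (sqrtr_ge0 _)).
  rewrite (sqrt_le g t g0 t0)/=.
  case: ifP => _; last by [].
  by rewrite -EFinM /h/= [in LHS]mulrA.
have inner_g (t : R) : (\int[mu]_g (Phi (g, t))%:E = if (0 < t)%R then
    (k t)%:E else 0)%E.
  have E : 0 <= t -> (\int[mu]_g (Phi (g, t))%:E = (c * expR (- t ^+ 2))%:E *
      \int[mu]_(x in `[0%R, (t ^+ 2 / zeta)%R]) (f x)%:E)%E.
    move=> t0; have ce0 : 0 <= c * expR (- t ^+ 2) := mulr_ge0 c0 (expR_ge0 _).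
    rewrite -[RHS]ge0_integralZl_EFin; [|by []|by move=> g _; rewrite lee_fin|
      by apply/measurable_EFinP; exact: measurable_funTS|by []].
    rewrite [RHS]integral_mkcond; apply: eq_integral => g _; rewrite patchE.
    rewrite /Phi/= t0/= mem_setE in_itv/= -(zeta_le g t).
    case: ifP => _; last by [].
    by rewrite -EFinM /h/= [in LHS]mulrCA [in LHS]mulrC.
  have [t0|t0|t0] := ltgtP 0 t.
  - by rewrite (E (ltW t0)) (fC _ (t2z t t0)) zK -EFinM -mulrA.
  - apply: integral0_eq => g _; rewrite /Phi/= [0 <= t]leNgt t0/=.
    by rewrite andbF.
  (* At t = 0 the range of g shrinks to the point 0, a null set. *)
  - rewrite E; last by rewrite -t0.
    by rewrite -t0 expr0n/= mul0r set_itv1 integral_set1 mule0.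
have main : (\int[mu]_(g in `[0%R, +oo[) (delta * erfc (Num.sqrt (zeta * g)) * f g)%:E =
    \int[mu]_w (delta / Num.sqrt pi * (expR (2^-1 * w - expR w) * C w))%:E)%E.
  transitivity (\int[mu]_g \int[mu]_t (Phi (g, t))%:E)%E.
    rewrite integral_mkcond; apply: eq_integral => g _.
    by rewrite inner_t patchE mem_setE in_itv/= andbT.
  rewrite [LHS]Fub; last 2 first.
  - exact/measurable_EFinP.
  - by move=> p; rewrite lee_fin.
  rewrite /=; transitivity (\int[mu]_(t in `]0%R, +oo[)
      (k t)%:E)%E.
    rewrite [RHS]integral_mkcond; apply: eq_integral => t _.
    by rewrite inner_g patchE mem_setE in_itv/= andbT.
  rewrite (@ge0_integration_by_substitution_expR _ 2^-1 k half0 ck k0).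
  by apply: eq_integral => w _; rewrite kE.
by rewrite -(RintegralZl _ measurableT iC); exact: (congr1 fine main).
Qed.

End error_rate.

(** * The distribution function of the maximum, and the resulting formula *)

Lemma continuous_logistic_prod (R : realType) n (beta lam : 'I_n -> R) :
  continuous (logistic_prod beta lam).
Proof.
have cF (l : 'I_n) : continuous (fun w => (1 + expR (- (lam l + beta l * w)))^-1).
  have cA : continuous (fun w : R => - (lam l + beta l * w)).
    move=> w; apply: cvgN; apply: cvgD; first exact: cvg_cst.
    by apply: cvgM; [exact: cvg_cst|exact: cvg_id].
  exact: (continuous_comp_fun cA (@continuous_oneDexpRV R)).
rewrite /logistic_prod; elim: (index_enum _) => [|l s IHs].
  by under eq_fun do rewrite big_nil; move=> w; exact: cvg_cst.
under eq_fun do rewrite big_cons.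
by move=> w; apply: cvgM; [exact: cF|exact: IHs].
Qed.

(** The maximum lies in [0, m] exactly when every X_l is at most m, the lower bound being provided
    by the default value 0 of the iterated maximum. Independence over the full index set then
    factors the probability. *)
Lemma integral_pdf_max d (T : measurableType d) (R : realType)
    (P : probability T R) n (X : 'I_n -> {RV P >-> R}) (f : R -> R) (m : R) :
  0 <= m -> mutually_independent X ->
  is_pdf P (fun omega => \big[Num.max/0]_(l < n) X l omega) f ->
  (\int[lebesgue_measure]_(x in `[0%R, m]) (f x)%:E =
   \prod_(l < n) cdf (X l) m)%E.
Proof.
move=> m0 indep [_ _ fP]; rewrite -fP//.
have := indep [set: 'I_n]%SET (fun _ => `]-oo, m]%classic) (fun _ => measurable_itv _).
rewrite (eq_bigl xpredT); last by move=> l; rewrite inE.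
move=> <-; congr (P _); apply/seteqP; split => [omega|omega] /=.
  rewrite in_itv/= => /andP[_ /bigmax_leP[_ Xm]] l _ /=.
  by rewrite in_itv/= Xm.
move=> Xm; rewrite in_itv/=; apply/andP; split.
  by apply/bigmax_geP; left.
apply/bigmax_leP; split => // l _.
by have := Xm l; rewrite /= inE in_itv/=; apply.
Qed.

(** With x = (zeta a)^(-b), both sides are 1 / (x (zeta m)^b); this puts F_l in logistic form at w =
    ln (zeta m). *)
Lemma powR_logistic (R : realType) (a b zeta m : R) : 0 < a -> 0 < zeta -> 0 < m ->
  (m / a) `^ (- b) = expR (- (ln ((zeta * a) `^ (- b)) + b * ln (zeta * m))).
Proof.
move=> a0 z0 m0.
rewrite ln_powR {1}/powR gt_eqF ?divr_gt0//; congr expR.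
by rewrite ln_div ?posrE// !lnM ?posrE//; ring.
Qed.

Theorem theorem1 (R : realType) (d : measure_display) (T : measurableType d)
    (P : probability T R) (L : nat) (rho delta zeta : R)
    (alpha beta : 'I_L -> R) (gamma : 'I_L -> {RV P >-> R})
    (f_SC : R -> R) (sigma : 'I_L -> R)
    (hL : (1 <= L)%N)
    (hrho : 0 < rho) (hdelta : 0 < delta) (hzeta : 0 < zeta)
    (halpha : forall l, 0 < alpha l) (hbeta : forall l, 0 < beta l)
    (hgamma_ge0 : forall l omega, 0 <= gamma l omega)
    (hgamma_indep : mutually_independent gamma)
    (hgamma_cdf : forall l (g : R), 0 < g ->
      cdf (gamma l) g =
      ((1 + (g / (rho * alpha l)) `^ (- beta l))^-1)%:E)
    (hf_SC : is_pdf P (fun omega => \big[Num.max/0]_(l < L) gamma l omega) f_SC)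
    (hsigma : forall l, 0 < sigma l < 1) :
  (avg_ber delta zeta f_SC)%:C =
  (delta / Num.sqrt pi)%:C *
  foxH beta sigma (fun l => (zeta * rho * alpha l) `^ (- beta l)).
Proof.
pose lam l := ln ((zeta * rho * alpha l) `^ (- beta l)).
pose C := logistic_prod beta lam.
have [mf f0 _] := hf_SC.
rewrite (@avg_ber_cdf _ _ _ _ C)//; last 3 first.
- exact: continuous_logistic_prod.
- by move=> w; exact: logistic_prod_itv.
- move=> m m0; rewrite (integral_pdf_max (ltW m0) hgamma_indep hf_SC).
  under eq_bigr do rewrite hgamma_cdf//.
  rewrite prodEFin; congr EFin; apply: eq_bigr => l _.
  rewrite (powR_logistic (beta l) (mulr_gt0 hrho (halpha l)) hzeta m0).
  by rewrite [zeta * (rho * alpha l)]mulrA.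
rewrite rmorphM; congr (_ * _).
have half : (2^-1 : R[i]) = (2^-1)%:C by rewrite fmorphV rmorph_nat.
have Re_half : 0 < complex.Re (2^-1 : R[i]) by rewrite half/= invr_gt0.
(* The scalar 1 plays the part of [c] in [vlines_integralE], with z = 1/2. *)
rewrite /foxH (_ : (fun s => _) = fun s : 'I_L -> R[i] =>
    1 * (GammaC (2^-1 + \sum_(l < L) (beta l)%:C * s l) *
    \prod_(l < L) (GammaC (1 - s l) * GammaC (s l) * expC (s l * (lam l)%:C)))); last first.
  by apply/funext => s; rewrite mul1r.
have A0 : (2 * pi)%:C * 'i%C != 0 :> R[i].
  rewrite mulf_neq0//; first by rewrite fmorph_eq0 mulf_neq0// gt_eqF ?pi_gt0.
  by rewrite eq_complex/= negb_and oner_eq0 orbT.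
rewrite vlines_integralE// exprVn mulKf ?expf_neq0// mul1r.
(* At z = 1/2 the kernel is real, so the complex integral is the image of a real one. *)
apply: etrans (esym (integralC_real _)) _; congr integralC; apply/funext => w.
have -> : Gamma_kernel 2^-1 w = (expR (2^-1 * w - expR w))%:C.
  rewrite /Gamma_kernel half (_ : (2^-1)%:C * w%:C = (2^-1 * w)%:C).
    by rewrite expC_real expRD rmorphM.
  by rewrite rmorphM.
by rewrite rmorphM.
Qed.
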